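(* There exists a non-Archimedean real closed field of transcendence degree two (over $\mathbb{Q}$) which is rigid, i.e. whose only field automorphism is the identity.
   Context: A real closed field is non-Archimedean if it contains an element larger than every natural number. A structure is rigid if its automorphism group is trivial. *)

(* Defs.v *)
From HB Require Import structures.
From mathcomp Require Import all_boot all_order all_algebra.
Set Implicit Arguments. Unset Strict Implicit. Unset Printing Implicit Defensive.
Import Order.TTheory GRing.Theory Num.Theory.
Local Open Scope ring_scope.

(* Evaluation of a bivariate rational polynomial p(X,Y), encoded as
   p : {poly {poly rat}} (outer variable Y, inner variable X), at (x, y). *)
Definition evalQ2 (R : rcfType) (x y : R) (p : {poly {poly rat}}) : R :=
  (map_poly (fun q : {poly rat} => (map_poly (@ratr R) q).[x]) p).[y].

Definition alg_indep2 (R : rcfType) (x y : R) : Prop :=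
  forall p : {poly {poly rat}}, p != 0 -> evalQ2 x y p != 0.

Definition in_Qxy (R : rcfType) (x y z : R) : Prop :=
  exists a b : {poly {poly rat}}, evalQ2 x y b != 0 /\ z = evalQ2 x y a / evalQ2 x y b.

Definition algebraic_over_Qxy (R : rcfType) (x y z : R) : Prop :=
  exists P : {poly R}, P != 0 /\ (forall i, in_Qxy x y P`_i) /\ root P z.

Definition trdeg2 (R : rcfType) : Prop :=
  exists x y : R, alg_indep2 x y /\ forall z : R, algebraic_over_Qxy x y z.

Definition non_archimedean (R : rcfType) : Prop :=
  exists x : R, forall n : nat, n%:R < x.

Definition rigid (R : rcfType) : Prop :=
  forall f : {rmorphism R -> R}, bijective f -> forall z, f z = z.

(* Main.v *)
Require Import Defs.
From HB Require Import structures.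
From mathcomp Require Import all_boot all_order all_algebra.
From mathcomp Require Import generic_quotient boolp classical_sets filter.
From mathcomp Require Import polyorder polyrcf realalg.
From mathcomp Require Import ring lra zify.
Set Implicit Arguments. Unset Strict Implicit. Unset Printing Implicit Defensive.
Import Order.TTheory GRing.Theory Num.Theory.
Local Open Scope classical_set_scope.
Local Open Scope quotient_scope.
Local Open Scope ring_scope.

(* The field is the real closed field of elements algebraic over Q(t, y), inside
   an ultrapower of the real algebraic numbers, where t > 0 is infinitesimal and
   y = t^(n_0) + t^(n_1) + ... for exponents n_k growing so fast that they
   diagonalise against all pairs of algebraic functions.  Write
   S_k = X^(n_0) + ... + X^(n_(k-1)) and e_k = y - S_k(t), which is about t^(n_k).

   Every nonzero element is bounded below by a power of t.  Let sigma be an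
   automorphism, u = sigma(t) and v = sigma(y), and suppose u > t (otherwise use
   the inverse of sigma).  Let A(t,y,u) = 0 and B(t,y,v) = 0 be simple roots, and
   let u_k be the root near u of A(t,S_k(t),-).  Then B(t,S_k(t),S_k(u_k)) is too
   small to be nonzero, by the choice of n_k, so the curve y = S_k(t) is mapped to
   itself, and a first-order expansion gives
     sigma(e_k) = (beta - alpha S_k'(u)) e_k + O(e_k^2)
   with alpha and beta independent of k.  Subtracting two consecutive instances
   shows that (u/t)^(n_k) converges faster than its increments, which are at least
   u/t - 1, allow.  Hence u = t; then v = y, because no nonzero element lies below
   all powers of t, and sigma fixes every algebraic element since it preserves the
   order of the roots of a polynomial. *)

(** * Ultrapowers of real closed fields *)

Section Ultrapower.
Variables (I : Type) (K : rcfType) (U : set_system I).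
Hypothesis UU : UltraFilter U.
Let FU : Filter U. Proof. exact: (@ultra_proper _ _ UU). Qed.
#[local] Existing Instance FU.

(** The [{classic _}] wrapper supplies the choice structure that the quotient type requires. *)
Definition ultra_eq (f g : {classic I -> K}) : bool := `[< U [set i | f i = g i] >].

Lemma ultra_eq_refl : reflexive ultra_eq.
Proof. by move=> f; apply/asboolP/filterE. Qed.

Lemma ultra_eq_sym : symmetric ultra_eq.
Proof. by move=> f g; apply/asboolP/asboolP; apply: filterS => i /=. Qed.

Lemma ultra_eq_trans : transitive ultra_eq.
Proof.
move=> g f h /asboolP fg /asboolP gh; apply/asboolP.
by apply: filterS2 fg gh => i /= ->.
Qed.

Canonical ultra_eq_equiv :=
  EquivRel ultra_eq ultra_eq_refl ultra_eq_sym ultra_eq_trans.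

Definition ultrapower := {eq_quot ultra_eq}.
HB.instance Definition _ := Choice.on ultrapower.

Definition germ (f : I -> K) : ultrapower := \pi_ultrapower (f : {classic I -> K}).

Lemma germ_eqP (f g : I -> K) : germ f = germ g <-> U [set i | f i = g i].
Proof. by split=> [/eqmodP/asboolP//|fg]; apply/eqmodP/asboolP. Qed.

Lemma germP (x : ultrapower) : exists f, x = germ f.
Proof. by exists (repr x); rewrite /germ reprK. Qed.

Lemma repr_germ (f : I -> K) : U [set i | (repr (germ f) : I -> K) i = f i].
Proof. by apply/germ_eqP; rewrite /germ reprK. Qed.

(** Primeness of the ultrafilter; it makes the order of the ultrapower total. *)
Lemma ultra_or (P Q : set I) : U [set i | P i \/ Q i] -> U P \/ U Q.
Proof.
move=> PQ; have [//|nP] := in_ultra_setVsetC P UU; first by left.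
by right; apply: filterS2 PQ nP => i /= [].
Qed.

(** Operations and relations are computed on the representatives chosen by [repr]; [ultra_lift1E],
    [ultra_lift2E] and [ultra_relP] show that other representatives give the same result. *)
Definition ultra_lift1 (h : K -> K) (x : ultrapower) : ultrapower :=
  germ (fun i => h ((repr x : I -> K) i)).
Definition ultra_lift2 (h : K -> K -> K) (x y : ultrapower) : ultrapower :=
  germ (fun i => h ((repr x : I -> K) i) ((repr y : I -> K) i)).
Definition ultra_rel (r : rel K) (x y : ultrapower) : bool :=
  `[< U [set i | r ((repr x : I -> K) i) ((repr y : I -> K) i)] >].

Lemma ultra_lift1E h f : ultra_lift1 h (germ f) = germ (fun i => h (f i)).
Proof. by apply/germ_eqP; apply: filterS (repr_germ f) => i /= ->. Qed.

Lemma ultra_lift2E h f g :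
  ultra_lift2 h (germ f) (germ g) = germ (fun i => h (f i) (g i)).
Proof.
by apply/germ_eqP; apply: filterS2 (repr_germ f) (repr_germ g) => i /= -> ->.
Qed.

Lemma ultra_relP (r : rel K) f g :
  reflect (U [set i | r (f i) (g i)]) (ultra_rel r (germ f) (germ g)).
Proof.
rewrite /ultra_rel; apply: (iffP (asboolP _)) => H.
  by apply: filterS3 (repr_germ f) (repr_germ g) H => i /= -> ->.
by apply: filterS3 (repr_germ f) (repr_germ g) H => i /= -> ->.
Qed.

Let zero := germ (fun=> 0).
Let one := germ (fun=> 1).
Let opp := ultra_lift1 (@GRing.opp K).
Let add := ultra_lift2 +%R.
Let mul := ultra_lift2 *%R.
Let inv := ultra_lift1 GRing.inv.

Ltac germs := repeat (let x := fresh "x" in let f := fresh "f" in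
  move=> x; have [f ->] := germP x; clear x); rewrite ?(ultra_lift1E, ultra_lift2E).

Let addA : associative add.
Proof. by rewrite /add; germs; apply/germ_eqP/filterE => i /=; rewrite addrA. Qed.
Let addC : commutative add.
Proof. by rewrite /add; germs; apply/germ_eqP/filterE => i /=; rewrite addrC. Qed.
Let add0 : left_id zero add.
Proof. by rewrite /add /zero; germs; apply/germ_eqP/filterE => i /=; rewrite add0r. Qed.
Let addN : left_inverse zero opp add.
Proof. by rewrite /add /opp; germs; apply/germ_eqP/filterE => i /=; rewrite addNr. Qed.

HB.instance Definition _ := GRing.isZmodule.Build ultrapower addA addC add0 addN.

Let mulA : associative mul.
Proof. by rewrite /mul; germs; apply/germ_eqP/filterE => i /=; rewrite mulrA. Qed.
Let mulC : commutative mul.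
Proof. by rewrite /mul; germs; apply/germ_eqP/filterE => i /=; rewrite mulrC. Qed.
Let mul1 : left_id one mul.
Proof. by rewrite /mul /one; germs; apply/germ_eqP/filterE => i /=; rewrite mul1r. Qed.
Let mulDl : left_distributive mul add.
Proof.
by rewrite /mul /add; germs; apply/germ_eqP/filterE => i /=; rewrite mulrDl.
Qed.
Let one_neq0 : one != 0.
Proof.
apply/eqP => /germ_eqP H; have [i /eqP] := @filter_ex _ _ (@ultra_proper _ _ UU) _ H.
by rewrite oner_eq0.
Qed.

HB.instance Definition _ :=
  GRing.Zmodule_isComNzRing.Build ultrapower mulA mulC mul1 mulDl one_neq0.

Let mulV : forall x : ultrapower, x != 0 -> inv x * x = 1.
Proof.
germs => /eqP x0; rewrite /inv ultra_lift1E; 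
  change (mul (germ (fun i => (f i)^-1)) (germ f) = one).
rewrite /mul ultra_lift2E.
apply/germ_eqP.
have [|] := in_ultra_setVsetC [set i | f i = 0] UU; first by move=> /germ_eqP /x0.
by apply: filterS => i /= /eqP fi; rewrite mulVf.
Qed.
Let inv0 : inv 0 = 0.
Proof.
change (inv zero = zero); rewrite /inv /zero ultra_lift1E.
by apply/germ_eqP/filterE => i; rewrite invr0.
Qed.

HB.instance Definition _ := GRing.ComNzRing_isField.Build ultrapower mulV inv0.

Lemma germ_add f g : germ f + germ g = germ (fun i => f i + g i).
Proof. exact: ultra_lift2E. Qed.
Lemma germ_mul f g : germ f * germ g = germ (fun i => f i * g i).
Proof. exact: ultra_lift2E. Qed.
Lemma germ_opp f : - germ f = germ (fun i => - f i).
Proof. exact: ultra_lift1E. Qed.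

Let le := ultra_rel <=%R.
Let lt := ultra_rel <%R.
Let norm := ultra_lift1 (@Num.norm _ K).

Let leP f g : reflect (U [set i | f i <= g i]) (le (germ f) (germ g)).
Proof. exact: ultra_relP. Qed.

Let le0_add (x y : ultrapower) : le 0 x -> le 0 y -> le 0 (x + y).
Proof.
have [f ->] := germP x; have [g ->] := germP y; rewrite germ_add => /leP H /leP H'.
by apply/leP; apply: filterS2 H H' => i /=; exact: addr_ge0.
Qed.
Let le0_mul (x y : ultrapower) : le 0 x -> le 0 y -> le 0 (x * y).
Proof.
have [f ->] := germP x; have [g ->] := germP y; rewrite germ_mul => /leP H /leP H'.
by apply/leP; apply: filterS2 H H' => i /=; exact: mulr_ge0.
Qed.
Let le0_anti (x : ultrapower) : le 0 x -> le x 0 -> x = 0.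
Proof.
have [f ->] := germP x => /leP H /leP H'; apply/germ_eqP.
by apply: filterS2 H H' => i /= fi fi'; apply/eqP; rewrite eq_le fi fi'.
Qed.
Let sub_ge0 (x y : ultrapower) : le 0 (y - x) = le x y.
Proof.
have [f ->] := germP x; have [g ->] := germP y; rewrite germ_opp germ_add.
by apply/leP/leP; apply: filterS => i /=; rewrite subr_ge0.
Qed.
Let le0_total (x : ultrapower) : le 0 x || le x 0.
Proof.
have [f ->] := germP x; apply/orP.
have : U [set i | 0 <= f i \/ f i <= 0].
  by apply: filterE => i /=; apply/orP; exact: le_total.
by move=> /ultra_or[] H; [left|right]; apply/leP.
Qed.
Let normN (x : ultrapower) : norm (- x) = norm x.
Proof.
have [f ->] := germP x; rewrite germ_opp /norm !ultra_lift1E.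
by apply/germ_eqP/filterE => i /=; rewrite normrN.
Qed.
Let ge0_norm (x : ultrapower) : le 0 x -> norm x = x.
Proof.
have [f ->] := germP x => /leP H; rewrite /norm ultra_lift1E; apply/germ_eqP.
by apply: filterS H => i /= /ger0_norm.
Qed.
Let lt_def (x y : ultrapower) : lt x y = (y != x) && le x y.
Proof.
have [f ->] := germP x; have [g ->] := germP y.
apply/ultra_relP/andP => [H|[/eqP H /leP H']].
  split; last by apply/leP; apply: filterS H => i /= /ltW.
  apply/eqP => /germ_eqP H'.
  have [i /= []] := @filter_ex _ _ (@ultra_proper _ _ UU) _ (filterI H H').
  by move=> /= + E; rewrite E ltxx.
have [|H2] := in_ultra_setVsetC [set i | g i = f i] UU; first by move=> /germ_eqP /H.
by apply: filterS2 H' H2 => i /= fg /eqP gf; rewrite lt_def gf.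
Qed.

HB.instance Definition _ := Num.IntegralDomain_isLeReal.Build ultrapower
  le0_add le0_mul le0_anti sub_ge0 le0_total normN ge0_norm lt_def.

Lemma germ_le f g : reflect (U [set i | f i <= g i]) (germ f <= germ g).
Proof. exact: ultra_relP. Qed.

Lemma germ_lt f g : reflect (U [set i | f i < g i]) (germ f < germ g).
Proof. exact: ultra_relP. Qed.

Lemma germ_sum m (F : 'I_m -> I -> K) :
  \sum_(j < m) germ (F j) = germ (fun i => \sum_(j < m) F j i).
Proof.
elim: m F => [|m IHm] F.
  by rewrite big_ord0; apply/germ_eqP/filterE => i /=; rewrite big_ord0.
rewrite big_ord_recr /= IHm germ_add.
by apply/germ_eqP/filterE => i /=; rewrite big_ord_recr.
Qed.

Lemma germ_exp f m : germ f ^+ m = germ (fun i => f i ^+ m).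
Proof.
elim: m => [|m IHm]; first by apply/germ_eqP/filterE => i /=; rewrite expr0.
by rewrite exprS IHm germ_mul; apply/germ_eqP/filterE => i /=; rewrite exprS.
Qed.

Lemma germ_nat m : m%:R = germ (fun=> m%:R).
Proof.
elim: m => [|m IHm]; first by apply/germ_eqP/filterE.
by rewrite mulrSr IHm germ_add; apply/germ_eqP/filterE => i /=; rewrite mulrSr.
Qed.

(** A polynomial over the ultrapower acts as a family of polynomials over [K], so that the
    intermediate value theorem can be applied index by index. *)
Lemma germ_horner (p : {poly ultrapower}) :
  exists q : I -> {poly K}, forall f, p.[germ f] = germ (fun i => (q i).[f i]).
Proof.
elim/poly_ind: p => [|p c [q IHq]].
  by exists (fun=> 0) => f; rewrite horner0; apply/germ_eqP/filterE => i /=; rewrite horner0.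
have [d ->] := germP c; exists (fun i => q i * 'X + (d i)%:P) => f.
rewrite hornerMXaddC IHq germ_mul germ_add.
by apply/germ_eqP/filterE => i /=; rewrite hornerMXaddC.
Qed.

Lemma ultrapower_ivt : Num.real_closed_axiom ultrapower.
Proof.
move=> p a b; have [q qE] := germ_horner p.
have [f ->] := germP a; have [g ->] := germP b; rewrite !qE => /germ_le fg.
move=> /andP[/germ_le pf /germ_le pg].
(* The root 0 is a placeholder at indices where the hypotheses fail; these form a set outside the
   ultrafilter. *)
have /choice[r rP] : forall i, exists x, f i <= g i -> (q i).[f i] <= 0 <= (q i).[g i] ->
    f i <= x <= g i /\ root (q i) x.
  move=> i; case: (boolP (f i <= g i)) => [fgi|]; last by exists 0.
  case: (boolP ((q i).[f i] <= 0 <= (q i).[g i])) => [H|]; last by exists 0.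
  by have [x] := poly_ivt fgi H; exists x.
exists (germ r).
  by apply/andP; split; apply/germ_le; apply: filterS3 fg pf pg => i /= fgi pfi pgi;
    have /(_ fgi)[|/andP[]] := rP i; rewrite ?pfi ?pgi.
rewrite rootE qE; apply/eqP/germ_eqP; apply: filterS3 fg pf pg => i /= fgi pfi pgi.
by have /(_ fgi)[|_ /rootP] := rP i; rewrite ?pfi ?pgi.
Qed.

HB.instance Definition _ := Num.RealField_isClosed.Build ultrapower ultrapower_ivt.

End Ultrapower.

(** * Lacunary sums of powers of an infinitesimal *)

Lemma lacunary_tail (K : realFieldType) (x : K) (n : nat -> nat) (k j : nat) :
  0 < x -> x * 2 <= 1 -> (forall i, n i < n i.+1)%N -> (k < j)%N ->
  x ^+ n k <= \sum_(i < j) x ^+ n i - \sum_(i < k) x ^+ n i <= x ^+ n k *+ 2.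
Proof.
move=> x_gt0 x_le nS kj; rewrite -(subnKC kj); move: (j - k.+1)%N => m.
have xX_ge0 m' : 0 <= x ^+ m' by rewrite exprn_ge0 // ltW.
have x_le1 : x <= 1 by lra.
have hS i : x ^+ n i.+1 *+ 2 <= x ^+ n i.
  have -> : n i.+1 = (n i + (n i.+1 - (n i).+1).+1)%N by have := nS i; lia.
  rewrite exprD exprSr -mulr_natr -mulrA ler_piMr //.
  by rewrite -mulrA mulr_ile1 ?mulr_ge0 ?exprn_ile1 // ltW.
(* Subtracting the last term from the upper bound makes the induction go through, since by [hS] each
   term is at most half of its predecessor. *)
suff : x ^+ n k <= \sum_(i < k.+1 + m) x ^+ n i - \sum_(i < k) x ^+ n i
    <= x ^+ n k *+ 2 - x ^+ n (k + m)%N.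
  by move=> /andP[-> /le_trans] /=; apply; rewrite gerDl oppr_le0.
elim: m => [|m /andP[IH1 IH2]].
  by rewrite !addn0 big_ord_recr /= [_ + x ^+ _]addrC addrK mulr2n addrK lexx.
rewrite addnS big_ord_recr /= -!addSnnS; have := hS (k + m)%N; have := xX_ge0 (n (k.+1 + m)%N).
rewrite -addSn; move: (x ^+ n k) (x ^+ n (k + m)%N) (x ^+ n (k.+1 + m)%N) IH1 IH2 => a b c.
by rewrite !mulr2n => IH1 IH2 H0 hSm; apply/andP; split; lra.
Qed.

(** In an ultrapower over an ultrafilter containing all final segments of [nat], [t] is the germ of
    1/(j+2), and the germ of the j-th partial sums stands for the infinite sum: from index k+1 on
    these satisfy the bounds for k. *)
Lemma nonarchimedean_rcf_with_lacunary_sums (K : rcfType) :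
  exists (L : rcfType) (t : L), 0 < t /\ (forall m, t *+ m < 1) /\
    forall n : nat -> nat, (forall k, n k < n k.+1)%N ->
    exists y : L, forall k,
      0 < y - \sum_(i < k) t ^+ n i /\ y - \sum_(i < k) t ^+ n i <= t ^+ n k *+ 2.
Proof.
have [U [UU sU]] := @ultraFilterLemma nat \oo _.
pose L : rcfType := ultrapower K UU.
pose h (j : nat) : K := j.+2%:R^-1.
have h0 j : 0 < h j by rewrite invr_gt0 ltr0n.
have h1 j : h j * 2 <= 1 by rewrite /h mulrC ler_pdivrMr ?ltr0n // mul1r ler_nat.
exists L, (germ UU h); split; [|split].
- by apply/germ_lt/filterE.
- move=> m; rewrite -mulr_natr germ_nat germ_mul; apply/germ_lt/sU; exists m => // j /= mj.
  by rewrite /h mulrC ltr_pdivrMr ?ltr0n // mul1r ltr_nat; lia.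
move=> n nS; exists (germ UU (fun j => \sum_(i < j) h j ^+ n i)) => k.
have E : germ UU (fun j => \sum_(i < j) h j ^+ n i) - \sum_(i < k) germ UU h ^+ n i
    = germ UU (fun j => \sum_(i < j) h j ^+ n i - \sum_(i < k) h j ^+ n i).
  under [X in _ - X]eq_bigr do rewrite germ_exp.
  by rewrite germ_sum germ_opp germ_add.
rewrite E germ_exp -mulr_natr germ_nat germ_mul; split.
  apply/germ_lt/sU; exists k.+1 => // j /= /(lacunary_tail (h0 j) (h1 j) nS) /andP[+ _].
  by apply: lt_le_trans; rewrite exprn_gt0.
apply/germ_le/sU; exists k.+1 => // j /= /(lacunary_tail (h0 j) (h1 j) nS) /andP[_].
by rewrite mulr_natr.
Qed.

(** * Relative algebraic closure in a real closed field *)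

Lemma map_polyMXaddC (A B : nzRingType) (f : {rmorphism A -> B}) (p : {poly A}) c :
  map_poly f (p * 'X + c%:P) = map_poly f p * 'X + (f c)%:P.
Proof. by rewrite rmorphD rmorphM /= map_polyX map_polyC. Qed.

Section RelativeAlgebraicClosure.
Variables (D : comNzRingType) (L : rcfType) (ev : {rmorphism D -> L}).

(** The field of fractions of the image of [ev], taken inside [L]. It is used for [evalQ2 t y], and
    for [evalQ2 t 0], where it is Q(t). *)
Definition frac_image : {pred L} :=
  fun z => `[< exists a b, ev b != 0 /\ z = ev a / ev b >].

Lemma frac_imageP z :
  reflect (exists a b, ev b != 0 /\ z = ev a / ev b) (z \in frac_image).
Proof. exact: asboolP. Qed.

Lemma frac_image_divring_closed : divring_closed frac_image.
Proof.
split.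
- by apply/frac_imageP; exists 1, 1; rewrite rmorph1 oner_eq0 divr1.
- move=> x y /frac_imageP[a [b [b0 ->]]] /frac_imageP[c [d [d0 ->]]].
  apply/frac_imageP; exists (a * d - c * b), (b * d).
  by rewrite rmorphB !rmorphM mulf_neq0 //; split=> //; field; apply/andP.
- move=> x y /frac_imageP[a [b [b0 ->]]] /frac_imageP[c [d [d0 ->]]].
  have [c0|c0] := eqVneq (ev c) 0.
    apply/frac_imageP; exists 0, 1; rewrite rmorph1 oner_eq0 rmorph0; split=> //.
    by rewrite c0 !mul0r invr0 mulr0.
  apply/frac_imageP; exists (a * d), (b * c).
  by rewrite !rmorphM mulf_neq0 //; split=> //; field; rewrite b0 c0 d0.
Qed.

HB.instance Definition _ :=
  GRing.isDivringClosed.Build L frac_image frac_image_divring_closed.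

Record frac_field := FracField { frac_val : L; _ : frac_val \in frac_image }.
HB.instance Definition _ := [isSub for frac_val].
HB.instance Definition _ := [Choice of frac_field by <:].
HB.instance Definition _ := [SubChoice_isSubIntegralDomain of frac_field by <:].
HB.instance Definition _ := [SubIntegralDomain_isSubField of frac_field by <:].

Definition alg_image : {pred L} :=
  fun z => `[< algebraicOver (val : frac_field -> L) z >].

Lemma alg_imageP z :
  reflect (algebraicOver (val : frac_field -> L) z) (z \in alg_image).
Proof. exact: asboolP. Qed.

Lemma alg_image_divring_closed : divring_closed alg_image.
Proof.
split; first exact/alg_imageP/algebraic1.
- by move=> x y /alg_imageP ax /alg_imageP ay; exact/alg_imageP/algebraic_sub.
- by move=> x y /alg_imageP ax /alg_imageP ay; exact/alg_imageP/algebraic_div.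
Qed.

HB.instance Definition _ :=
  GRing.isDivringClosed.Build L alg_image alg_image_divring_closed.

Lemma clear_denominators (p : {poly frac_field}) :
  exists d (P : {poly D}), ev d != 0 /\ map_poly ev P = ev d *: map_poly val p.
Proof.
elim/poly_ind: p => [|p c [d [P [d0 PE]]]].
  by exists 1, 0; rewrite !rmorph0 rmorph1 oner_eq0 scaler0.
have /frac_imageP[a [b [b0 /= cE]]] := valP c.
exists (d * b), (b *: P * 'X + (d * a)%:P); rewrite rmorphM mulf_neq0 //; split=> //.
rewrite (etrans (map_polyMXaddC val p c) (congr1 (fun z => _ + z%:P) cE)).
rewrite map_polyMXaddC map_polyZ PE -!mul_polyC [ev (d * a)]rmorphM.
have -> : ev d * ev a = ev d * ev b * (ev a / ev b) by field.
by rewrite !polyCM; ring.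
Qed.

(** Annihilators can be taken with coefficients in [D] itself. For [D] a polynomial ring, the same
    annihilator can then be evaluated at other points, such as (t, S_k(t)). *)
Lemma alg_image_rootP z :
  reflect (exists P, map_poly ev P != 0 /\ root (map_poly ev P) z) (z \in alg_image).
Proof.
apply: (iffP (alg_imageP z)) => [[p p0 pz]|[P [P0 Pz]]].
  have [d [P [d0 PE]]] := clear_denominators p; exists P; rewrite PE.
  by rewrite scaler_eq0 (negbTE d0) map_poly_eq0 p0 rootZ.
have evf a : ev a \in frac_image.
  by apply/frac_imageP; exists a, 1; rewrite rmorph1 oner_eq0 divr1.
pose p := \poly_(i < size P) FracField (evf P`_i).
have pE : map_poly val p = map_poly ev P.
  apply/polyP => i; rewrite !coef_map coef_poly /=; case: ltnP => //= Pi.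
  by rewrite nth_default // !rmorph0.
by exists p; rewrite ?pE // -(map_poly_eq0 val) pE.
Qed.

Lemma alg_image_ev a : ev a \in alg_image.
Proof.
apply/alg_image_rootP; exists ('X - a%:P).
by rewrite rmorphB /= map_polyX map_polyC polyXsubC_eq0 root_XsubC.
Qed.

(** Transitivity of algebraicity, by way of integrality, which over a field is the same notion. *)
Lemma alg_image_root (p : {poly L}) z :
  p != 0 -> p \is a polyOver alg_image -> root p z -> z \in alg_image.
Proof.
move=> p0 /polyOverP pA pz; apply/alg_imageP/integral_algebraic.
apply: integral_root p0 pz _; apply/integral_poly => i.
exact/integral_algebraic/alg_imageP.
Qed.

Record alg_field := AlgField { alg_val : L; _ : alg_val \in alg_image }.
HB.instance Definition _ := [isSub for alg_val].
HB.instance Definition _ := [Choice of alg_field by <:].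
HB.instance Definition _ := [SubChoice_isSubIntegralDomain of alg_field by <:].
HB.instance Definition _ := [SubIntegralDomain_isSubField of alg_field by <:].

Let le (x y : alg_field) := val x <= val y.
Let lt (x y : alg_field) := val x < val y.
Let norm (x : alg_field) : alg_field := if le 0 x then x else - x.

Let le0_add x y : le 0 x -> le 0 y -> le 0 (x + y).
Proof. by rewrite /le rmorph0 rmorphD; exact: addr_ge0. Qed.
Let le0_mul x y : le 0 x -> le 0 y -> le 0 (x * y).
Proof. by rewrite /le rmorph0 rmorphM; exact: mulr_ge0. Qed.
Let le0_anti x : le 0 x -> le x 0 -> x = 0.
Proof.
by rewrite /le rmorph0 => x0 x0'; apply/val_inj/eqP; rewrite rmorph0 eq_le x0 x0'.
Qed.
Let sub_ge0 x y : le 0 (y - x) = le x y.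
Proof. by rewrite /le rmorph0 rmorphB subr_ge0. Qed.
Let le0_total x : le 0 x || le x 0.
Proof. exact: le_total. Qed.
Let normN x : norm (- x) = norm x.
Proof.
rewrite /norm /le rmorph0 rmorphN oppr_ge0 opprK.
case: (ltgtP 0 (val x)) => // x0.
by have -> : x = 0 by [exact: val_inj]; rewrite oppr0.
Qed.
Let ge0_norm x : le 0 x -> norm x = x.
Proof. by rewrite /norm => ->. Qed.
Let lt_def x y : lt x y = (y != x) && le x y.
Proof. by rewrite /lt /le lt_def (inj_eq val_inj). Qed.

HB.instance Definition _ := Num.IntegralDomain_isLeReal.Build alg_field
  le0_add le0_mul le0_anti sub_ge0 le0_total normN ge0_norm lt_def.

Lemma alg_field_ivt : Num.real_closed_axiom alg_field.
Proof.
move=> p a b ab; have [->|p0] := eqVneq p 0; first by exists a; rewrite ?root0 ?lexx.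
have valE x : val p.[x] = (map_poly val p).[val x] by rewrite horner_map.
move=> /andP[pa pb].
have H : (map_poly val p).[val a] <= 0 <= (map_poly val p).[val b].
  by rewrite -!valE -(rmorph0 (val : alg_field -> L)); apply/andP.
have [z zab pz] := poly_ivt (ab : val a <= val b) H.
(* Relative algebraic closedness puts the root found in [L] back into the subfield. *)
have zA : z \in alg_image.
  apply: alg_image_root pz; first by rewrite map_poly_eq0.
  by apply/polyOverP => i; rewrite coef_map; exact: valP.
exists (AlgField zA) => //.
by rewrite rootE -(inj_eq val_inj) valE rmorph0 -rootE.
Qed.

HB.instance Definition _ := Num.RealField_isClosed.Build alg_field alg_field_ivt.

Lemma alg_val_le (x y : alg_field) : (x <= y) = (val x <= val y).
Proof. by []. Qed.
Lemma alg_val_lt (x y : alg_field) : (x < y) = (val x < val y).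
Proof. by []. Qed.

End RelativeAlgebraicClosure.

(** * Taylor estimates and implicit roots *)

Section Evaluation.
Variables (R : rcfType) (x y : R).

Let evalQ2E (p : {poly {poly rat}}) : evalQ2 x y p =
  (horner_eval y \o map_poly (horner_eval x \o map_poly (@ratr R))) p.
Proof. by []. Qed.

Lemma evalQ2_is_zmod_morphism : zmod_morphism (evalQ2 x y).
Proof. by move=> p q; rewrite !evalQ2E rmorphB. Qed.

Lemma evalQ2_is_monoid_morphism : monoid_morphism (evalQ2 x y).
Proof. by split=> [|p q]; rewrite !evalQ2E ?rmorph1 ?rmorphM. Qed.

HB.instance Definition _ :=
  GRing.isZmodMorphism.Build {poly {poly rat}} R (evalQ2 x y) evalQ2_is_zmod_morphism.
HB.instance Definition _ :=
  GRing.isMonoidMorphism.Build {poly {poly rat}} R (evalQ2 x y) evalQ2_is_monoid_morphism.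

Lemma evalQ2_polyC (q : {poly rat}) : evalQ2 x y q%:P = (map_poly ratr q).[x].
Proof. by rewrite evalQ2E /= map_polyC /horner_eval hornerC. Qed.

Lemma evalQ2_X : evalQ2 x y 'X = y.
Proof. by rewrite evalQ2E /= map_polyX /horner_eval hornerX. Qed.

Lemma evalQ2_map (S : rcfType) (f : {rmorphism R -> S}) p :
  f (evalQ2 x y p) = evalQ2 (f x) (f y) p.
Proof.
rewrite /evalQ2 -horner_map; congr (_.[_]).
apply/polyP => i; rewrite coef_map !coef_map_id0 ?rmorph0 ?horner0 //=.
rewrite -horner_map; congr (_.[_]).
by apply/polyP => j; rewrite !coef_map /= fmorph_rat.
Qed.

End Evaluation.

Section Taylor.
Variable (F : realFieldType).

(* [fin] is a bounding semiring: all of [F], or the natural numbers when the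
   constant has to stay below every infinite element. *)
Lemma taylor1 (fin : F -> Prop) (fin0 : fin 0) (fin1 : fin 1)
    (finD : forall a b, fin a -> fin b -> fin (a + b))
    (finM : forall a b, fin a -> fin b -> fin (a * b))
    (p : {poly F}) (y Y : F) :
  fin Y -> `|y| <= Y -> (forall i, exists2 C, fin C & `|p`_i| <= C) ->
  exists M, [/\ fin M, `|p.[y]| <= M, `|p^`().[y]| <= M &
    forall e, `|e| <= 1 -> `|p.[y + e] - p.[y] - p^`().[y] * e| <= M * e ^+ 2].
Proof.
move=> finY yY; elim/poly_ind: p => [_|p c IHp pC].
  exists 0; rewrite deriv0 !horner0 normr0 lexx; split=> // e _.
  by rewrite !horner0 mul0r !subr0 normr0 mul0r.
have [|M [finMM pM dM tM]] := IHp.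
  move=> i; have [C finC pC'] := pC i.+1; exists C => //.
  by move: pC'; rewrite coefD coefMX coefC /= addr0.
have [C finC] := pC 0%N; rewrite coefD coefMX coefC /= add0r => cC.
have M0 : 0 <= M := le_trans (normr_ge0 _) pM.
have Y0 : 0 <= Y := le_trans (normr_ge0 _) yY.
have C0 : 0 <= C := le_trans (normr_ge0 _) cC.
exists (M * (Y + 1 + 1) + C); split.
- by apply: (finD) => //; apply: (finM) => //; apply: (finD) => //; apply: (finD).
- rewrite hornerMXaddC (le_trans (ler_normD _ _)) ?lerD // normrM.
  by apply: ler_pM => //; rewrite (le_trans yY) // -addrA lerDl addr_ge0.
- rewrite derivMXaddC !hornerE (le_trans (ler_normD _ _)) // normrM.
  have : `|p^`().[y]| * `|y| <= M * Y by exact: ler_pM.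
  by move=> ?; lra.
move=> e e1; rewrite derivMXaddC hornerD hornerMX !hornerMXaddC; set r := _ - _ - _.
have := tM e e1; set s := (X in `|X|) => sM.
have -> : r = s * (y + e) + p^`().[y] * e ^+ 2 by rewrite /r /s; ring.
rewrite (le_trans (ler_normD _ _)) // normrM [X in _ + X]normrM.
rewrite [`|e ^+ 2|]ger0_norm ?sqr_ge0 //.
have ye : `|y + e| <= Y + 1 by rewrite (le_trans (ler_normD _ _)) // lerD.
have : `|s| * `|y + e| <= M * e ^+ 2 * (Y + 1) by exact: ler_pM.
have : `|p^`().[y]| * e ^+ 2 <= M * e ^+ 2 by rewrite ler_wpM2r // sqr_ge0.
have : 0 <= C * e ^+ 2 by rewrite mulr_ge0 // sqr_ge0.
by move=> *; lra.
Qed.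

End Taylor.

Lemma taylor_field (F : realFieldType) (p : {poly F}) (y : F) :
  exists M, 0 <= M /\
    forall e, `|e| <= 1 -> `|p.[y + e] - p.[y] - p^`().[y] * e| <= M * e ^+ 2.
Proof.
have [|M [_ pM _ tM]] := @taylor1 F (fun=> True) I I (fun _ _ _ _ => I)
  (fun _ _ _ _ => I) p y `|y| I (lexx _).
  by move=> i; exists `|p`_i|.
by exists M; split=> //; exact: le_trans pM.
Qed.

(* The polynomial A(t, y, -), where the outermost variable of [A] is kept. *)
Definition slice (F : rcfType) (t y : F) (A : {poly {poly {poly rat}}}) : {poly F} :=
  map_poly (evalQ2 t y) A.

Lemma sliceMXaddC (F : rcfType) (t y : F) A c :
  slice t y (A * 'X + c%:P) = slice t y A * 'X + (evalQ2 t y c)%:P.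
Proof. by rewrite /slice rmorphD rmorphM /= map_polyX map_polyC. Qed.

(** [g] plays the part of the partial derivative in the second variable; it is left existential
    since only the slopes -g/p formed from it occur later. *)
Lemma taylor2 (F : rcfType) (t y u : F) (A : {poly {poly {poly rat}}}) :
  exists g M, 0 <= M /\ forall e a, `|e| <= 1 -> `|a| <= 1 ->
    `|(slice t (y + e) A).[u + a] - (slice t y A).[u] - g * e - (slice t y A)^`().[u] * a|
      <= M * (e ^+ 2 + a ^+ 2).
Proof.
elim/poly_ind: A => [|A c [g [M [M0 IH]]]].
  exists 0, 0; split=> // e a _ _; rewrite /slice !rmorph0 deriv0 !horner0 !mul0r.
  by rewrite !subr0 normr0.
pose C := map_poly (fun q : {poly rat} => (map_poly (@ratr F) q).[t]) c.
have [N [N0 tC]] := taylor_field C y.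
pose G := (slice t y A)^`().[u].
exists (g * u + C^`().[y]), (M * (`|u| + 1) + `|g| + `|G| + N); split.
  by rewrite !addr_ge0 ?mulr_ge0 ?addr_ge0.
move=> e a e1 a1; rewrite !sliceMXaddC derivMXaddC hornerD hornerMX !hornerMXaddC -/G.
have := IH e a e1 a1; rewrite -/G; set r := (X in `|X|) => rM.
have := tC e e1; rewrite -/(evalQ2 t (y + e) c) -/(evalQ2 t y c); set s := (X in `|X|) => sN.
set w := (X in `|X| <= _).
(* The cross term is of second order because |e a| <= e^2 + a^2. *)
have -> : w = r * (u + a) + g * (e * a) + G * a ^+ 2 + s by rewrite /w /r /s; ring.
have ea : `|e * a| <= e ^+ 2 + a ^+ 2.
  rewrite normrM -[e ^+ 2]real_normK ?num_real // -[a ^+ 2]real_normK ?num_real //.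
  have := sqr_ge0 (`|e| - `|a|); have := mulr_ge0 (normr_ge0 e) (normr_ge0 a).
  by move=> *; nra.
have e2 := sqr_ge0 e; have a2 := sqr_ge0 a.
have H1 : `|r * (u + a)| <= M * (e ^+ 2 + a ^+ 2) * (`|u| + 1).
  by rewrite normrM ler_pM // (le_trans (ler_normD _ _)) // lerD.
have H2 : `|g * (e * a)| <= `|g| * (e ^+ 2 + a ^+ 2) by rewrite normrM ler_wpM2l.
have H3 : `|G * a ^+ 2| <= `|G| * a ^+ 2 by rewrite normrM [`|a ^+ 2|]ger0_norm.
have H4 : 0 <= `|G| * e ^+ 2 by rewrite mulr_ge0.
have H5 : 0 <= N * a ^+ 2 by rewrite mulr_ge0.
have := ler_normD (r * (u + a) + g * (e * a) + G * a ^+ 2) s.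
have := ler_normD (r * (u + a) + g * (e * a)) (G * a ^+ 2).
have := ler_normD (r * (u + a)) (g * (e * a)).
move: rM sN; clear -H1 H2 H3 H4 H5 e2 a2; move=> *; lra.
Qed.

(** A quantitative implicit function theorem, with [alpha] the slope of the root as a function of y.
    The root is found by the intermediate value property, between [alpha * e - d] and
    [alpha * e + d]. *)
Lemma implicit_root (F : rcfType) (t y u : F) (A : {poly {poly {poly rat}}}) :
  root (slice t y A) u -> (slice t y A)^`().[u] != 0 ->
  exists alpha M, 0 <= M /\ forall e, M * `|e| <= 1 -> exists a,
    root (slice t (y + e) A) (u + a) /\ `|a - alpha * e| <= M * e ^+ 2.
Proof.
move=> /rootP Au0; have [g [M [M0 tM]]] := taylor2 t y u A.
move: ((slice t y A)^`().[u]) tM => p tM p0.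
(* [K] is such that |p| d, with d = K e^2, equals the Taylor remainder bound for |a| <= (|alpha| +
   1) |e|. *)
pose alpha := - g / p; pose K := M * (1 + (`|alpha| + 1) ^+ 2) / `|p|.
have K0 : 0 <= K by rewrite mulr_ge0 ?invr_ge0 // mulr_ge0 // addr_ge0 // sqr_ge0.
exists alpha, (K + `|alpha| + 1); split; first by rewrite !addr_ge0.
move=> e He; have e0 := normr_ge0 e.
have H1 : 0 <= K * `|e| by rewrite mulr_ge0.
have H2 : 0 <= `|alpha| * `|e| by rewrite mulr_ge0.
have e1 : `|e| <= 1 by lra.
have e2 : e ^+ 2 = `|e| ^+ 2 by rewrite real_normK ?num_real.
pose d := K * e ^+ 2.
have d0 : 0 <= d by rewrite mulr_ge0 // sqr_ge0.
have de : d <= `|e|.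
  by rewrite /d e2 expr2 mulrA -[X in _ <= X]mul1r ler_wpM2r //; lra.
(* The terms g e and p alpha e cancel, which leaves p s up to an error |p| d; this fixes the signs
   at s = d and s = -d. *)
have key s : `|s| <= d -> `|(slice t (y + e) A).[u + (alpha * e + s)] - p * s| <= `|p| * d.
  move=> sd; set a := alpha * e + s.
  have an : `|a| <= (`|alpha| + 1) * `|e|.
    rewrite (le_trans (ler_normD _ _)) // normrM mulrDl mul1r lerD //.
    exact: le_trans de.
  have a1 : `|a| <= 1 by lra.
  have := tM e a e1 a1; rewrite Au0 subr0.
  have -> : (slice t (y + e) A).[u + a] - g * e - p * a
     = (slice t (y + e) A).[u + a] - p * s by rewrite /a /alpha; field.
  move=> /le_trans; apply.
  have -> : `|p| * d = M * (e ^+ 2 + ((`|alpha| + 1) * `|e|) ^+ 2).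
    by rewrite /d /K exprMn -e2; field; rewrite normr_eq0.
  rewrite ler_wpM2l // lerD2l -[a ^+ 2]real_normK ?num_real //.
  by rewrite lerXn2r ?nnegrE // mulr_ge0 // addr_ge0.
have dn : `|d| = d by rewrite ger0_norm.
have := key d; have := key (- d); rewrite normrN dn lexx => /(_ isT) kN /(_ isT) kP.
suff [a /andP[a_ge a_le] ra] : exists2 a, u + (alpha * e - d) <= a <= u + (alpha * e + d)
    & root (slice t (y + e) A) a.
  exists (a - u); rewrite [u + _]addrC subrK; split=> //.
  rewrite ler_norml; apply/andP; split.
    have : 0 <= (`|alpha| + 1) * e ^+ 2 by rewrite mulr_ge0 ?sqr_ge0 // addr_ge0.
    by rewrite /d in a_ge a_le *; move=> *; lra.
  have : 0 <= (`|alpha| + 1) * e ^+ 2 by rewrite mulr_ge0 ?sqr_ge0 // addr_ge0.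
  by rewrite /d in a_ge a_le *; move=> *; lra.
have le_ends : u + (alpha * e - d) <= u + (alpha * e + d) by lra.
have [p_gt|p_lt|p00] := ltgtP 0 p; last by rewrite p00 eqxx in p0.
  apply: poly_ivt => //; move: kN kP; rewrite !(gtr0_norm p_gt) !ler_norml.
  by move=> /andP[? ?] /andP[? ?]; apply/andP; split; lra.
have [|a Ha] := @poly_ivt _ (- slice t (y + e) A) _ _ le_ends; last first.
  by rewrite rootN; exists a.
rewrite !hornerN; move: kN kP; rewrite !(ltr0_norm p_lt) !ler_norml.
by move=> /andP[? ?] /andP[? ?]; apply/andP; split; lra.
Qed.

(** * Powers of an infinitesimal *)

Definition fin (F : realFieldType) (z : F) := exists m : nat, `|z| <= m%:R.

Section Finite.
Variable F : realFieldType.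
Implicit Types (p : {poly F}) (q : {poly rat}).

Lemma taylor_fin p (y : F) : fin y -> (forall i, fin p`_i) ->
  exists m : nat, [/\ `|p.[y]| <= m%:R, `|p^`().[y]| <= m%:R &
    forall e, `|e| <= 1 -> `|p.[y + e] - p.[y] - p^`().[y] * e| <= m%:R * e ^+ 2].
Proof.
move=> [Y yY] pC.
have [|||||||M [[m ->] pM dM tM]] :=
  @taylor1 F (fun z => exists m : nat, z = m%:R) _ _ _ _ p y Y%:R.
- by exists 0%N.
- by exists 1%N.
- by move=> _ _ [a ->] [b ->]; exists (a + b)%N; rewrite natrD.
- by move=> _ _ [a ->] [b ->]; exists (a * b)%N; rewrite natrM.
- by exists Y.
- by [].
- by move=> i; have [C iC] := pC i; exists C%:R => //; exists C.
by exists m.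
Qed.

Lemma fin_ratr (a : rat) : fin (ratr a : F).
Proof.
exists (Num.bound `|a|); rewrite -ratr_norm -[X in _ <= X]ratr_nat ler_rat.
exact/ltW/archi_boundP.
Qed.

Lemma fin_nonneg_nat (z : F) : fin z -> exists2 m : nat, (0 < m)%N & `|z| <= m%:R.
Proof.
by move=> [m zm]; exists m.+1 => //; rewrite (le_trans zm) // ler_nat.
Qed.

Lemma fin_ratr_low (a : rat) : a != 0 ->
  exists2 m : nat, (0 < m)%N & 1 <= m%:R * `|ratr a : F|.
Proof.
move=> a0; have [m m0 am] := fin_nonneg_nat (fin_ratr a^-1); exists m => //.
rewrite fmorphV normfV in am; rewrite -ler_pdivrMr ?div1r //.
by rewrite normr_gt0 fmorph_eq0.
Qed.

Lemma fin_rat_poly q (x : F) : fin x -> fin (map_poly ratr q).[x].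
Proof.
move=> xf; have [|m [qm _ _]] := @taylor_fin (map_poly ratr q) x xf; last by exists m.
by move=> i; rewrite coef_map; exact: fin_ratr.
Qed.

End Finite.

Section Infinitesimal.
Variables (F : rcfType) (t : F).
Hypotheses (t_gt0 : 0 < t) (t_inf : forall m, t *+ m < 1).

Definition above_power (z : F) := exists N, t ^+ N < `|z|.

Lemma t_lt1 : t < 1. Proof. by have := t_inf 1; rewrite mulr1n. Qed.

Lemma tX_gt0 N : 0 < t ^+ N. Proof. exact: exprn_gt0. Qed.

Lemma tX_le M N : (N <= M)%N -> t ^+ M <= t ^+ N.
Proof. by move=> NM; rewrite ler_wiXn2l ?ltW ?t_lt1. Qed.

Lemma tX_nat N m : t ^+ N.+1 * m%:R < t ^+ N.
Proof.
rewrite exprSr -mulrA mulr_natr -[X in _ < X]mulr1.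
by rewrite ltr_pM2l // tX_gt0.
Qed.

(** A natural factor costs one power of [t], since [t] times any natural number stays below 1. *)
Lemma above_power_nat a z (m : nat) : above_power a -> `|a| <= m%:R * `|z| -> above_power z.
Proof.
move=> [N aN] az; exists N.+1; rewrite ltNge; apply/negP => zN.
have : t ^+ N < t ^+ N; last by rewrite ltxx.
rewrite (lt_trans aN) // (le_lt_trans az) // (le_lt_trans _ (tX_nat N m)) //.
by rewrite mulrC ler_wpM2r.
Qed.

(** Once the powers of X are divided out, the constant term c is nonzero and c = - z P(z). For |z|
    <= 1 the value P(z) is finite, so z is as large as c up to a natural factor. *)
Lemma root_above_power (P : {poly F}) z : P != 0 ->
  (forall i, P`_i = 0 \/ above_power P`_i) -> (forall i, fin P`_i) ->
  root P z -> z != 0 -> above_power z.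
Proof.
move=> + + + + z0; have [z1|z1] := ltP 1 `|z|.
  by move=> *; exists 1%N; rewrite expr1 (lt_trans t_lt1).
elim/poly_ind: P => [|P c IH]; first by rewrite eqxx.
move=> Pc0 low finP Pz.
have coefS i : (P * 'X + c%:P)`_i.+1 = P`_i by rewrite coefD coefMX coefC addr0.
have coef0 : (P * 'X + c%:P)`_0 = c by rewrite coefD coefMX coefC add0r.
have [c0|c0] := eqVneq c 0.
  apply: IH; rewrite ?c0 ?addr0 in Pc0 low finP Pz *.
  - by apply: contra_neq Pc0 => ->; rewrite mul0r.
  - by move=> i; have := low i.+1; rewrite coefMX.
  - by move=> i; have := finP i.+1; rewrite coefMX.
  - by move: Pz; rewrite rootM rootX (negbTE z0) orbF.
have [||m [Pm _ _]] := @taylor_fin _ P z.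
- by exists 1%N.
- by move=> i; rewrite -coefS.
have := low 0%N; rewrite coef0 => -[/eqP|lowc]; first by rewrite (negbTE c0).
apply: (above_power_nat (m := m) lowc); move/rootP: Pz; rewrite hornerMXaddC => /eqP.
rewrite addrC addr_eq0 => /eqP ->; rewrite normrN normrM ler_wpM2r //.
Qed.

(** The lowest nonzero coefficient dominates: factors of [t] are split off until the constant term
    is nonzero, and then the absolute value exceeds [t]. *)
Lemma rat_poly_above_power (q : {poly rat}) : q != 0 -> above_power (map_poly ratr q).[t].
Proof.
have ft : fin t by exists 1%N; rewrite gtr0_norm // ltW // t_lt1.
elim/poly_ind: q => [|q c IH]; first by rewrite eqxx.
move=> qc0; rewrite map_polyMXaddC hornerMXaddC /=.
have [c0|c0] := eqVneq c 0.
  rewrite c0 addr0 in qc0 *; rewrite rmorph0 addr0.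
  have [|N qN] := IH; first by apply: contra_neq qc0 => ->; rewrite mul0r.
  by exists N.+1; rewrite normrM (gtr0_norm t_gt0) exprSr ltr_pM2r.
have [m m0 cm] := fin_ratr_low F c0; have [M M0 qM] := fin_nonneg_nat (fin_rat_poly q ft).
move: (ratr c : F) cm ((map_poly _ _).[t]) qM => d dm p pM.
exists 1%N; rewrite expr1.
have H1 : `|d| <= `|p * t + d| + M%:R * t.
  rewrite -[X in `|X| <= _](addKr (p * t)) (le_trans (ler_normD _ _)) // normrN addrC.
  by rewrite lerD2l normrM (gtr0_norm t_gt0) ler_pM2r.
rewrite ltNge; apply/negP => H2.
have := t_inf (m * (M + 1)); rewrite -mulr_natr natrM natrD => H3.
have : m%:R * `|d| <= m%:R * (t + M%:R * t).
  by rewrite ler_wpM2l // (le_trans H1) // lerD2r.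
by move=> *; lra.
Qed.

Lemma evalQ2_fin (y : F) p : fin y -> fin (evalQ2 t y p).
Proof.
have ft : fin t by exists 1%N; rewrite gtr0_norm // ltW // t_lt1.
move=> fy; rewrite /evalQ2; set P := map_poly _ _.
have [|m [Pm _ _]] := @taylor_fin _ P y fy; last by exists m.
by move=> i; rewrite coef_map_id0 ?rmorph0 ?horner0 //; exact: fin_rat_poly.
Qed.

(** With 0 for the second variable, [alg_image] consists of the elements algebraic over Q(t), whose
    annihilators have coefficients of the form q(t). *)
Lemma alg_image_rat_above_power z :
  z \in alg_image (evalQ2 t 0) -> z = 0 \/ above_power z.
Proof.
have [->|z0] := eqVneq z 0; first by left.
move=> /alg_image_rootP[P [P0 Pz]]; right; apply: (root_above_power P0) => // i; last first.
  by rewrite coef_map; apply: evalQ2_fin; exists 0%N; rewrite normr0.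
rewrite coef_map /= /evalQ2 horner_coef0 coef_map_id0 ?rmorph0 ?horner0 //.
have [->|] := eqVneq (P`_i)`_0 0; first by left; rewrite rmorph0 horner0.
by move=> /rat_poly_above_power; right.
Qed.

End Infinitesimal.

(** * Diagonal choice of the exponents *)

Lemma evalQ2_divring (F : rcfType) (S : divringClosed F) x y p :
  x \in S -> y \in S -> evalQ2 x y p \in S.
Proof.
move=> xS yS; apply: rpred_horner => //; apply/polyOverP => i.
rewrite coef_map_id0 ?rmorph0 ?horner0 //; apply: rpred_horner => //.
by apply/polyOverP => j; rewrite coef_map rpred_rat.
Qed.

Definition rat_eval (F : rcfType) (S : {poly rat}) (x : F) : F := (map_poly ratr S).[x].

Lemma rpred_rat_eval (F : rcfType) (P : divringClosed F) S x :
  x \in P -> rat_eval S x \in P.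
Proof.
by move=> xP; apply: rpred_horner => //; apply/polyOverP => j; rewrite coef_map rpred_rat.
Qed.

Section Diagonal.
Variables (F : rcfType) (t : F).
Hypotheses (t_gt0 : 0 < t) (t_inf : forall m, t *+ m < 1).

(** A(t, S(t), -) has finitely many roots u, each algebraic over Q(t), and so is B(t, S(t), S(u)).
    Each nonzero value is above a power of [t]; the largest exponent serves all roots. *)
Lemma exists_uniform_bound (A B : {poly {poly {poly rat}}}) (S : {poly rat}) :
  exists N, forall u, slice t (rat_eval S t) A != 0 -> root (slice t (rat_eval S t) A) u ->
    (slice t (rat_eval S t) B).[rat_eval S u] != 0 ->
    t ^+ N < `|(slice t (rat_eval S t) B).[rat_eval S u]|.
Proof.
set s := rat_eval S t; have [->|A0] := eqVneq (slice t s A) 0; first by exists 0%N.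
have tA : t \in alg_image (evalQ2 t 0).
  have := alg_image_ev (evalQ2 t 0) 'X%:P.
  by rewrite /= evalQ2_polyC map_polyX hornerX.
have sA : s \in alg_image (evalQ2 t 0) by exact: rpred_rat_eval.
have sliceA C : slice t s C \is a polyOver (alg_image (evalQ2 t 0)).
  by apply/polyOverP => i; rewrite coef_map; exact: evalQ2_divring.
have [N HN] : exists N, forall u, u \in rootsR (slice t s A) -> root (slice t s A) u ->
    (slice t s B).[rat_eval S u] != 0 -> t ^+ N < `|(slice t s B).[rat_eval S u]|.
  elim: (rootsR _) => [|v r [N IH]]; first by exists 0%N.
  have [M HM] : exists M, root (slice t s A) v -> (slice t s B).[rat_eval S v] != 0 ->
      t ^+ M < `|(slice t s B).[rat_eval S v]|.
    have [vA|] := boolP (root (slice t s A) v); last by exists 0%N.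
    have vAlg := alg_image_root A0 (sliceA A) vA.
    have [->|[M HM]] := alg_image_rat_above_power t_gt0 t_inf
      (rpred_horner (sliceA B) (rpred_rat_eval S vAlg)); first by exists 0%N; rewrite eqxx.
    by exists M.
  exists (maxn N M) => u; rewrite in_cons => /orP[/eqP->|ur] uA uB.
    by apply: le_lt_trans (HM uA uB); rewrite tX_le // leq_maxr.
  by apply: le_lt_trans (IH u ur uA uB); rewrite tX_le // leq_maxl.
exists N => u _ uA; apply: HN => //.
by rewrite -(roots_on_rootsR A0) uA in_itv.
Qed.

Definition lacunary (n : nat -> nat) k : {poly rat} := \sum_(i < k) 'X^(n i).

(* [n k] is chosen after [lacunary n k] is known, so as to beat the bounds of
   [exists_uniform_bound] for all pairs [(A, B)] with codes at most [k]. *)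
Lemma exists_diagonal_exponents : exists n : nat -> nat,
  (forall k, (n k).*2.+2 <= n k.+1)%N /\
  forall A B m, exists k0, forall k, (k0 <= k)%N -> forall u,
    let S := lacunary n k in let s := rat_eval S t in
    slice t s A != 0 -> root (slice t s A) u -> (slice t s B).[rat_eval S u] != 0 ->
    exists N, t ^+ N < `|(slice t s B).[rat_eval S u]| /\ (N * m <= n k)%N.
Proof.
pose code := {poly {poly {poly rat}}}.
have [N HN] := choice (fun x : code * code * {poly rat} =>
  exists_uniform_bound x.1.1 x.1.2 x.2).
(* Pairs (A, B) are enumerated by [pickle]; codes that decode to nothing cost 0, and [K S k]
   dominates the cost of every pair with codes at most k. *)
pose cost (S : {poly rat}) (i j : nat) :=
  if (unpickle i : option code) is Some A then
    if (unpickle j : option code) is Some B then N (A, B, S) else 0%N else 0%N.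
pose K S k := (\sum_(i < k.+1) \sum_(j < k.+1) cost S i j)%N.
(* The state is the pair (S_k, n_k). The factor k absorbs any fixed m once k >= m; the last summand
   gives the growth condition. *)
pose st := fix st k := if k is k'.+1 then
    let S := (st k').1 + 'X^((st k').2) in (S, K S k * k + ((st k').2).*2.+2)%N
  else (0 : {poly rat}, 0%N).
pose n k := (st k).2; exists n; split=> [k|A B m]; first exact: leq_addl.
have SE k : lacunary n k = (st k).1.
  elim: k => [|k IH]; first by rewrite /lacunary big_ord0.
  by rewrite /lacunary big_ord_recr /= -/(lacunary n k) IH.
exists (maxn (maxn (pickle A) (pickle B)) m) => k.
rewrite !geq_max => /andP[/andP[Ak Bk] mk] u S s A0 Au Bu.
exists (N (A, B, S)); split; first exact: (HN (A, B, S)).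
have NK : (N (A, B, S) <= K S k)%N.
  have -> : N (A, B, S) = cost S (pickle A) (pickle B) by rewrite /cost !pickleK.
  rewrite /K (bigD1 (Ordinal (Ak : pickle A < k.+1)%N)) //=.
  rewrite (bigD1 (Ordinal (Bk : pickle B < k.+1)%N)) //= -addnA; exact: leq_addr.
case: k => [|k] in Ak Bk mk S s A0 Au Bu NK *.
  by move: mk; rewrite leqn0 => /eqP ->; rewrite muln0.
have -> : n k.+1 = (K (lacunary n k.+1) k.+1 * k.+1 + (n k).*2.+2)%N by rewrite SE.
apply: leq_trans (leq_addr _ _); exact: leq_mul.
Qed.

End Diagonal.

(** * Automorphisms *)

Lemma rat_eval_lacunaryS (F : rcfType) n k (x : F) :
  rat_eval (lacunary n k.+1) x = rat_eval (lacunary n k) x + x ^+ n k.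
Proof.
by rewrite /rat_eval /lacunary big_ord_recr /= rmorphD /= map_polyXn hornerD hornerXn.
Qed.

Lemma rat_eval_rmorph (F G : rcfType) (f : {rmorphism F -> G}) S x :
  f (rat_eval S x) = rat_eval S (f x).
Proof.
rewrite /rat_eval -horner_map; congr (_.[_]).
by apply/polyP => j; rewrite !coef_map /= fmorph_rat.
Qed.

Section RcfMorphism.
Variables (F : rcfType) (f : {rmorphism F -> F}).

(** Positive elements are the nonzero squares, a notion that ring morphisms of fields preserve. *)
Lemma rmorph_rcf_gt0 x : 0 < x -> 0 < f x.
Proof.
move=> x0; rewrite -(sqr_sqrtr (ltW x0)) rmorphXn /= exprn_even_gt0 //=.
by rewrite fmorph_eq0 sqrtr_eq0 -ltNge.
Qed.

Lemma rmorph_rcf_lt x z : x < z -> f x < f z.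
Proof. by rewrite -subr_gt0 => /rmorph_rcf_gt0; rewrite rmorphB subr_gt0. Qed.

(* The orbit of [z] is strictly monotone and stays among the roots of [P]. *)
Lemma rmorph_rcf_fixes_root (P : {poly F}) z :
  P != 0 -> map_poly f P = P -> root P z -> f z = z.
Proof.
move=> P0 fP Pz; pose zs i := iter i f z.
have zs_root i : root P (zs i).
  by elim: i => // i IH; rewrite -fP /zs iterS; exact: rmorph_root.
apply/eqP/negPn/negP => fz.
have zs_inj : injective zs.
  have [lt_z|gt_z|E] := ltgtP z (f z); last by rewrite -E eqxx in fz.
    have zsS i : zs i < zs i.+1 by elim: i => // i IH; exact: rmorph_rcf_lt IH.
    have zs_lt := homo_ltn lt_trans zsS.
    by move=> i j E; case: (ltngtP i j) => // /zs_lt; rewrite E ltxx.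
  have zsS i : zs i > zs i.+1 by elim: i => // i IH; exact: rmorph_rcf_lt IH.
  have zs_gt := homo_ltn (r := fun a b => b < a) (fun a b c ba cb => lt_trans cb ba) zsS.
  by move=> i j E; case: (ltngtP i j) => // /zs_gt; rewrite E ltxx.
have : (size [seq zs i | i <- iota 0 (size P)] < size P)%N.
  apply: max_poly_roots => //; first by apply/allP => _ /mapP[i _ ->].
  by rewrite map_inj_uniq ?iota_uniq.
by rewrite size_map size_iota ltnn.
Qed.

End RcfMorphism.

(** * Sizes of elements, algebraic independence of t and y, and rigidity *)

Section DiagonalField.
Variables (F : rcfType) (t y : F) (n : nat -> nat).
Hypotheses (t_gt0 : 0 < t) (t_inf : forall m, t *+ m < 1).
Hypothesis n_growth : forall k, ((n k).*2.+2 <= n k.+1)%N.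

Let S k := lacunary n k.
Let e k := y - rat_eval (S k) t.

Hypothesis e_bounds : forall k, 0 < e k /\ e k <= t ^+ n k *+ 2.
Hypothesis diag : forall A B m, exists k0, forall k, (k0 <= k)%N -> forall u,
  let s := rat_eval (S k) t in
  slice t s A != 0 -> root (slice t s A) u -> (slice t s B).[rat_eval (S k) u] != 0 ->
  exists N, t ^+ N < `|(slice t s B).[rat_eval (S k) u]| /\ (N * m <= n k)%N.
Hypothesis algebraic : forall z, exists A, slice t y A != 0 /\ root (slice t y A) z.

Let t_lt1 := t_lt1 t_inf.
Let tX_gt0 := tX_gt0 t_gt0.
Let tX_le := tX_le t_gt0 t_inf.
Let tX_nat := tX_nat t_gt0 t_inf.

Let n_ge k : (k <= n k)%N.
Proof. by elim: k => // k IH; have := n_growth k; lia. Qed.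

Let n_ltS k : (n k < n k.+1)%N.
Proof. by have := n_growth k; lia. Qed.

Let e_gt0 k : 0 < e k. Proof. by case: (e_bounds k). Qed.
Let e_le k : e k <= 2 * t ^+ n k.
Proof. by rewrite mulr_natl; case: (e_bounds k). Qed.

Let eS k : e k = e k.+1 + t ^+ n k.
Proof. by rewrite /e /S rat_eval_lacunaryS; ring. Qed.

Let e_mono k j : (k < j)%N -> e j < e k.
Proof.
elim: j => // j IH; rewrite ltnS leq_eqVlt => /orP[/eqP ->|/IH].
  by rewrite (eS j) ltrDl.
by apply: lt_trans; rewrite (eS j) ltrDl.
Qed.

Let sE k : rat_eval (S k) t = y - e k. Proof. by rewrite /e; ring. Qed.

Let fin_y : fin y.
Proof.
exists 2%N; have := e_le 0; have := e_gt0 0.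
rewrite {1 2}/e /S /lacunary big_ord0 /rat_eval rmorph0 horner0 subr0 => y0 /le_trans.
by rewrite gtr0_norm //; apply; rewrite ler_piMr // exprn_ile1 // ltW.
Qed.

Let coefQ (p : {poly {poly rat}}) : {poly F} :=
  map_poly (fun q : {poly rat} => (map_poly (@ratr F) q).[t]) p.

Let coefQ_neq0 p : p != 0 -> coefQ p != 0.
Proof.
move=> p0; apply/eqP => /polyP/(_ (size p).-1); rewrite coef0 coef_map_id0; last first.
  by rewrite rmorph0 horner0.
have /(rat_poly_above_power t_gt0 t_inf)[N] : lead_coef p != 0 by rewrite lead_coef_eq0.
by rewrite /lead_coef => /[swap] ->; rewrite normr0 ltNge ltW.
Qed.

Let e_le1 k : (0 < k)%N -> e k <= 1.
Proof.
move=> k0; have /tX_le : (1 <= n k)%N := leq_trans k0 (n_ge k).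
by have := e_le k; have := t_inf 2; rewrite expr1 mulr2n => *; lra.
Qed.

Let fin_coefQ p i : fin (coefQ p)`_i.
Proof.
rewrite coef_map_id0 ?rmorph0 ?horner0 //; apply: fin_rat_poly.
by exists 1%N; rewrite gtr0_norm // ltW.
Qed.

Lemma evalQ2_lipschitz p : exists m : nat, forall k, (0 < k)%N ->
  `|evalQ2 t y p - evalQ2 t (rat_eval (S k) t) p| <= t ^+ n k * m%:R.
Proof.
have [m [_ dm tm]] := taylor_fin fin_y (fin_coefQ p).
(* The linear and the quadratic part are each at most m e_k, and e_k <= 2 t^(n_k). *)
exists (4 * m)%N => k k0; have ek := e_gt0 k; have ek1 := e_le1 k0; have ek2 := e_le k.
have := tm (- e k); rewrite normrN gtr0_norm // ek1 => /(_ isT).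
rewrite sE -/(evalQ2 t y p) -/(evalQ2 t (y - e k) p).
move: (evalQ2 t y p) (evalQ2 t (y - e k) p) => a b.
rewrite sqrrN mulrN opprK => H; rewrite distrC.
have -> : b - a = (b - a + (coefQ p)^`().[y] * e k) - (coefQ p)^`().[y] * e k by ring.
rewrite (le_trans (ler_normB _ _)) // normrM (gtr0_norm ek).
have H1 : `|(coefQ p)^`().[y]| * e k <= m%:R * e k by rewrite ler_wpM2r // ltW.
have H2 : m%:R * e k ^+ 2 <= m%:R * e k by rewrite expr2 mulrA ler_piMr // mulr_ge0 // ltW.
have H3 : m%:R * e k <= m%:R * (2 * t ^+ n k) by rewrite ler_wpM2l.
by rewrite natrM; lra.
Qed.

(** The diagonal property is applied to A = X with root 0 and B = p, constant in the last variable.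
    Its value p(t, S_k(t)) lies above t^N with 2 N <= n_k, while p(t, y) differs from it by at most
    a natural multiple of t^(n_k). *)
Lemma evalQ2_above_power p : p != 0 -> above_power t (evalQ2 t y p).
Proof.
move=> p0; have [m Hm] := evalQ2_lipschitz p.
have [k0 Hk0] := diag 'X p%:P 2.
(* p(t, Y) has finitely many roots, whereas the S_k(t) are pairwise distinct. The bound k >= 4 gives
   N + 2 <= n_k from 2 N <= n_k. *)
have [k /andP[k0k k4] pk] : exists2 k, (k0 <= k)%N && (4 <= k)%N
    & evalQ2 t (rat_eval (S k) t) p != 0.
  apply: contrapT => H; pose P := coefQ p.
  pose rs := [seq rat_eval (S k) t | k <- iota (k0 + 4) (size P)].
  have : (size rs < size P)%N; last by rewrite size_map size_iota ltnn.
  apply: max_poly_roots; first exact: coefQ_neq0.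
    apply/allP => _ /mapP[k + ->]; rewrite mem_iota => /andP[kk _].
    apply/rootP/eqP; apply: contrapT => /negP Pk; apply: H.
    by exists k => //; apply/andP; split; lia.
  rewrite map_inj_uniq ?iota_uniq // => i j; rewrite !sE => /addrI/oppr_inj ij.
  by case: (ltngtP i j) => // /e_mono; rewrite ij ltxx.
have sX : slice t (rat_eval (S k) t) 'X = 'X by rewrite /slice map_polyX.
have := Hk0 k k0k 0; rewrite /= sX polyX_eq0 rootX eqxx => /(_ isT isT).
rewrite /slice map_polyC hornerC => /(_ pk)[N [pN nN]].
have := Hm k (leq_trans _ k4); rewrite distrC => /(_ isT).
move: pN; rewrite /=; move: (evalQ2 t y p) (evalQ2 _ _ p) => a b bN ba.
exists N.+1.
have /tX_le H1 : (N.+2 <= n k)%N by have := n_ge k; lia.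
have H2 := tX_nat N.+1 m.
have H3 : t ^+ n k * m%:R <= t ^+ N.+2 * m%:R by rewrite ler_wpM2r.
have H4 := tX_nat N 2.
have : `|b| <= `|b - a| + `|a| by rewrite -[X in `|X| <= _](subrK a) ler_normD.
by move=> *; lra.
Qed.

Lemma above_power_neq0 z : z != 0 -> above_power t z.
Proof.
move=> z0; have [A [A0 Az]] := algebraic z; apply: (root_above_power t_gt0 t_inf A0) => // i.
  rewrite coef_map /=; have [->|/evalQ2_above_power] := eqVneq A`_i 0; last by right.
  by left; rewrite rmorph0.
by rewrite coef_map; apply: evalQ2_fin.
Qed.

(** The leading coefficient survives replacing y by S_k(t): it is above a fixed power of [t], and it
    changes by at most a natural multiple of t^(n_k). *)
Lemma slice_neq0 A : slice t y A != 0 ->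
  exists K, forall k, (K <= k)%N -> slice t (rat_eval (S k) t) A != 0.
Proof.
move=> A0; set i := (size (slice t y A)).-1.
have : lead_coef (slice t y A) != 0 by rewrite lead_coef_eq0.
rewrite /lead_coef -/i coef_map /= => /[dup] c0 /above_power_neq0[N cN].
have [m Hm] := evalQ2_lipschitz A`_i; exists N.+1 => k Nk.
have := Hm k (leq_ltn_trans (leq0n N) Nk).
apply: contraTneq => /polyP/(_ i); rewrite coef0 coef_map /= => ->.
rewrite subr0 -ltNge (le_lt_trans _ (lt_trans (tX_nat N m) cN)) // ler_wpM2r //.
exact/tX_le/(leq_trans Nk).
Qed.

Lemma diagonal_alg_indep2 : alg_indep2 t y.
Proof.
move=> p /evalQ2_above_power[N].
by apply: contraTneq => ->; rewrite normr0 -leNgt ltW.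
Qed.

Lemma bounded_by_t z : exists N, z * t ^+ N <= 1.
Proof.
have [->|z0] := eqVneq z 0; first by exists 0%N; rewrite mul0r.
have [N] := above_power_neq0 (invr_neq0 z0); rewrite normfV => zN; exists N.
rewrite (le_trans (ler_norm _)) // normrM [`|t ^+ N|]gtr0_norm //.
by rewrite mulrC -ler_pdivlMr ?normr_gt0 // mul1r ltW.
Qed.

(* In characteristic 0 an annihilator of minimal degree has [z] as a simple root. *)
Lemma simple_annihilator z :
  exists A, root (slice t y A) z /\ (slice t y A)^`().[z] != 0.
Proof.
have [A [A0 Az]] := algebraic z; have [m] := ubnP (size (slice t y A)).
elim: m A A0 Az => // m IH A A0 Az Am.
have [dA|dA] := eqVneq ((slice t y A)^`().[z]) 0; last by exists A.
have E : slice t y A^`() = (slice t y A)^`() by rewrite /slice deriv_map.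
apply: (IH A^`()); rewrite E; last 2 first.
- exact/rootP.
- by rewrite -ltnS (leq_trans _ Am) // ltnS lt_size_deriv.
rewrite -size_poly_gt0 polyorder.size_deriv.
by have := root_size_gt1 A0 Az; case: (size _) => [|[]].
Qed.

(** * An automorphism that enlarges t *)

Section Automorphism.
Variable f : {rmorphism F -> F}.
Hypotheses (f_t : t < f t) (t_im : exists w, f w = t).

Let u := f t.
Let v := f y.
Let E k := v - rat_eval (S k) u.
Let dS k := (map_poly ratr (S k))^`().[u].

Let u_gt0 : 0 < u. Proof. exact: rmorph_rcf_gt0. Qed.

Let u_inf m : u *+ m < 1.
Proof. by rewrite -(rmorph1 f) -rmorphMn /=; exact: rmorph_rcf_lt. Qed.

Let u_lt1 : u < 1. Proof. by have := u_inf 1; rewrite mulr1n. Qed.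

Let E_eq k : E k = f (e k).
Proof. by rewrite /E /e rmorphB rat_eval_rmorph. Qed.

Let E_gt0 k : 0 < E k. Proof. by rewrite E_eq rmorph_rcf_gt0. Qed.

Let E_le k : E k <= 2 * u ^+ n k.
Proof.
have [_] := e_bounds k; rewrite le_eqVlt => /orP[/eqP|/(rmorph_rcf_lt f)].
  by rewrite E_eq => ->; rewrite rmorphMn rmorphXn mulr_natl.
by rewrite E_eq rmorphMn rmorphXn mulr_natl => /ltW.
Qed.

Let ES k : E k = E k.+1 + u ^+ n k.
Proof. by rewrite !E_eq eS rmorphD rmorphXn. Qed.

(** [f] is applied to t^N < |w| for a preimage w of [t]. Hence powers of [u] get below every power
    of [t], although u > t. *)
Lemma uX_lt_t : exists m, u ^+ m.+1 < t.
Proof.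
have [w fw] := t_im.
have w0 : w != 0 by apply: contraTneq t_gt0 => w0; rewrite -fw w0 rmorph0 ltxx.
have [N tN] := above_power_neq0 w0.
have fw' : f `|w| = t.
  have [w_ge0|w_lt0] := leP 0 w; first by rewrite ger0_norm.
  have := rmorph_rcf_lt f w_lt0; rewrite fw rmorph0 => /lt_trans/(_ t_gt0).
  by rewrite ltxx.
exists N; rewrite -fw'; apply: le_lt_trans (rmorph_rcf_lt f tN).
by rewrite rmorphXn exprS ler_piMl ?exprn_ge0 // ltW.
Qed.

Lemma eventually_small (M : F) N : exists K, forall j, (K <= j)%N -> M * u ^+ j <= t ^+ N.
Proof.
have [m um] := uX_lt_t; have [M0|M0] := ltP M 0.
  exists 0%N => j _; rewrite (@le_trans _ _ 0) //; last by rewrite ltW.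
  by rewrite nmulr_rle0 // exprn_ge0 // ltW.
have [C MC] := bounded_by_t M; exists (m.+1 * (C + N))%N => j Kj.
have H : u ^+ j <= t ^+ (C + N).
  rewrite (@le_trans _ _ (u ^+ (m.+1 * (C + N)))) //.
    by rewrite ler_wiXn2l ?ltW.
  by rewrite exprM lerXn2r ?nnegrE ?exprn_ge0 // ltW.
rewrite (@le_trans _ _ (M * t ^+ (C + N))) // ?ler_wpM2l //.
by rewrite exprD mulrA ler_piMl // ltW.
Qed.

Let tu_le j : t ^+ j <= u ^+ j.
Proof. by rewrite lerXn2r ?nnegrE // ltW. Qed.

(** The bound [m] varies with k but is a natural number, hence m t < 1: multiplication by [t] makes
    estimates uniform in k. *)
Lemma taylor_S k : exists m : nat, `|dS k| <= m%:R /\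
  forall a, `|a| <= 1 ->
    `|rat_eval (S k) (u + a) - rat_eval (S k) u - dS k * a| <= m%:R * a ^+ 2.
Proof.
have [||m [_ dm tm]] := @taylor_fin _ (map_poly ratr (S k)) u.
- by exists 1%N; rewrite gtr0_norm // ltW.
- by move=> i; rewrite coef_map; exact: fin_ratr.
by exists m.
Qed.

Lemma dS_succ k : dS k.+1 = dS k + u ^+ (n k).-1 *+ n k.
Proof.
rewrite /dS /S /lacunary big_ord_recr /= rmorphD /= map_polyXn derivD derivXn.
by rewrite hornerD hornerMn hornerXn.
Qed.

(** [alpha] and [beta] are the slopes in y of the roots of A and B. For the root u + a near u and d
    = v - S_k(u + a), up to second order a = - alpha e_k, d = beta e_k and E_k = d + S_k'(u) a. The
    factor [t] keeps [M] independent of k. *)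
Lemma first_order_estimate : exists alpha beta M K, 0 <= M /\ forall k, (K <= k)%N ->
  `|E k - (beta - alpha * dS k) * e k| * t <= M * e k ^+ 2.
Proof.
have [A [Au dA]] := simple_annihilator u; have [B [Bv dB]] := simple_annihilator v.
have [alpha [M1 [M1_ge0 Hroot]]] := implicit_root Au dA.
have [g [M2 [M2_ge0 tB]]] := taylor2 t y v B.
move/rootP in Bv; rewrite Bv in tB; move: (_^`().[v]) dB tB => p p0 tB.
have [K1 HK1] : exists K, forall k, (K <= k)%N -> slice t (rat_eval (S k) t) A != 0.
  by apply: slice_neq0; apply: contraNneq dA => ->; rewrite deriv0 horner0.
(* Smallness is measured in powers of [u]; the factor m0+1 pays for the exchange into powers of [t],
   and the 2 leaves half of n_k for the constants. *)
have [m0 um0] := uX_lt_t; have [K2 HK2] := diag A B (m0.+1 * 2).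
(* [M3], [M4], [M5], [M6] and [M8] will bound |a| / e_k, |z| / (e_k + |d|), |z| t / U, |b| / (e_k^2
   + d^2) and |d| / e_k. *)
pose M3 := `|alpha| + 1; have M3_ge0 : 0 <= M3 by rewrite addr_ge0.
pose M4 := `|g| + `|p| + M2; have M4_ge0 : 0 <= M4 by rewrite !addr_ge0.
pose M5 := M4 * (4 + 4 * M3).
have M5_ge0 : 0 <= M5 by rewrite mulr_ge0 // addr_ge0 // mulr_ge0.
pose M6 := M2 / `|p|; have M6_ge0 : 0 <= M6 by rewrite mulr_ge0 // invr_ge0.
pose beta := - g / p; pose M8 := 2 * (`|beta| + M6).
have M8_ge0 : 0 <= M8 by rewrite mulr_ge0 // addr_ge0.
have [C HC] := bounded_by_t M5.
have [K3 HK3] := eventually_small (2 * M1) 0.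
have [K4 HK4] := eventually_small (2 * M3) 2.
have [K5 HK5] := eventually_small (2 * (M6 + 1) * (2 + 4 * M3)) 1.
exists alpha, beta, (M6 * (1 + M8 ^+ 2) + M1 + M3 ^+ 2).
exists (K1 + K2 + K3 + K4 + K5 + 2 * (2 + C) * m0.+1 + 1)%N; split.
  by rewrite !addr_ge0 ?sqr_ge0 // mulr_ge0 // addr_ge0 ?sqr_ge0.
move=> k Kk; have nk := n_ge k.
have [k1 k2 [k3 k4 k5] k6 kC] : [/\ (K1 <= k)%N, (K2 <= k)%N,
    [/\ (K3 <= n k)%N, (K4 <= n k)%N & (K5 <= n k)%N], (0 < k)%N &
    (2 * (2 + C) * m0.+1 <= n k)%N].
  move: Kk nk; move: (2 * (2 + C) * m0.+1)%N => X; clear.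
  by move=> *; split; [| |split| |]; lia.
move: {HK1 HK2 HK3 HK4 HK5} (HK1 k k1) (HK2 k k2) (HK3 _ k3) (HK4 _ k4) (HK5 _ k5).
move=> HK1 HK2 HK3 HK4 HK5; rewrite expr0 in HK3; rewrite expr1 in HK5.
have ek0 := e_gt0 k; have ek1 := e_le1 k6.
have eu : e k <= 2 * u ^+ n k by rewrite (le_trans (e_le k)) // ler_pM2l.
have Eu := E_le k; have Ek0 := E_gt0 k; set U := u ^+ n k in HK3 HK4 HK5 eu Eu.
have U_ge0 : 0 <= U by rewrite exprn_ge0 // ltW.
have [|a [ra Ha]] := Hroot (- e k).
  by rewrite normrN gtr0_norm // (le_trans _ HK3) // [2 * M1]mulrC -mulrA ler_wpM2l.
rewrite mulrN opprK sqrrN in Ha.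
have [mk [dm tm]] := taylor_S k; have mt : mk%:R * t < 1 by rewrite mulr_natl.
have e2_le : M1 * e k ^+ 2 <= e k.
  rewrite expr2 mulrA ler_piMl ?(ltW ek0) // (le_trans _ HK3) // [2 * M1]mulrC -mulrA.
  by rewrite ler_wpM2l.
have a_le : `|a| <= M3 * e k.
  rewrite -[a](addrK (alpha * e k)) (le_trans (ler_normB _ _)) // normrM (gtr0_norm ek0).
  by rewrite /M3 mulrDl mul1r addrC lerD2l (le_trans Ha).
have a_t2 : `|a| <= t ^+ 2.
  rewrite (le_trans a_le) // (le_trans _ HK4) // [2 * M3]mulrC -mulrA.
  by rewrite ler_wpM2l.
have t_ge0 : 0 <= t := ltW t_gt0.
have mt_le1 : mk%:R * t <= 1 := ltW mt.
have a_le1 : `|a| <= 1 by rewrite (le_trans a_t2) // exprn_ile1 // ltW.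
have {}tm := tm a a_le1; set r := dS k in tm dm *.
set tau := _ - _ in tm; pose d := v - rat_eval (S k) (u + a).
have dE : E k = d + r * a + tau by rewrite /E /d /tau; ring.
have a_ge0 := normr_ge0 a; have mk_ge0 : 0 <= mk%:R :> F by [].
have ma2 : mk%:R * a ^+ 2 * t <= `|a|.
  have -> : mk%:R * a ^+ 2 * t = mk%:R * t * `|a| * `|a|.
    by rewrite -(real_normK (num_real a)); ring.
  by rewrite ler_piMl // mulr_ile1 // mulr_ge0.
have ra_t : `|r * a| * t <= `|a|.
  by rewrite normrM mulrAC ler_piMl // (le_trans _ mt_le1) // ler_wpM2r.
(* A first crude bound on d; the sharper |d| <= M8 e_k has to wait for z = 0. *)
have d_t : `|d| * t <= (2 + 4 * M3) * U.
  have -> : d = E k - (r * a + tau) by rewrite dE; ring.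
  have H1 : `|E k - (r * a + tau)| <= E k + (`|r * a| + `|tau|).
    by rewrite (le_trans (ler_normB _ _)) // lerD ?ler_normD // gtr0_norm.
  have H2 : `|tau| * t <= `|a| by rewrite (le_trans _ ma2) // ler_wpM2r // ltW.
  have H3 : `|E k - (r * a + tau)| * t <= (E k + (`|r * a| + `|tau|)) * t.
    by rewrite ler_wpM2r // ltW.
  have H4 : E k * t <= E k by rewrite ler_piMr // ltW.
  have H5 : M3 * e k <= M3 * (2 * U) by rewrite ler_wpM2l.
  by lra.
(* This smallness later absorbs the quadratic term M6 d^2 into |d| / 2. *)
have d_small : 2 * (M6 + 1) * `|d| <= 1.
  have : 2 * (M6 + 1) * (`|d| * t) <= 2 * (M6 + 1) * ((2 + 4 * M3) * U).
    by rewrite ler_wpM2l // mulr_ge0 // addr_ge0.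
  by move=> H; rewrite -(ler_pM2r t_gt0); lra.
have d_ge0 := normr_ge0 d; have M6d_ge0 : 0 <= M6 * `|d| by rewrite mulr_ge0.
have d_le1 : `|d| <= 1 by lra.
have vd : v - d = rat_eval (S k) (u + a) by rewrite /d; ring.
have := tB (- e k) (- d); rewrite !normrN gtr0_norm // ek1 => /(_ isT d_le1).
rewrite subr0 -sE vd; set z := (slice _ _ _).[_] => tBd.
have e_sq : e k ^+ 2 <= e k by rewrite expr2 ler_piMl // ltW.
have d_sq : d ^+ 2 = `|d| * `|d| by rewrite -(real_normK (num_real d)) expr2.
(* |z| t is at most M5 U. A nonzero z would exceed t^N with N small against n_k; raising to the
   power m0+1 and comparing exponents of [t] gives a contradiction. *)
have z0 : z = 0.
  apply: contrapT => /eqP z0; rewrite -sE in ra; have [N [zN Nn]] := HK2 _ HK1 ra z0.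
  have z_le : `|z| <= M4 * (e k + `|d|).
    have H1 : `|z| <= `|z - g * - e k - p * - d| + (`|g| * e k + `|p| * `|d|).
      have {1}-> : z = (z - g * - e k - p * - d) - (g * e k + p * d) by ring.
      rewrite (le_trans (ler_normB _ _)) // lerD2l (le_trans (ler_normD _ _)) //.
      by rewrite !normrM (gtr0_norm ek0).
    have H2 : `|d| * `|d| <= `|d| by rewrite ler_piMl.
    have H3 : M2 * (e k ^+ 2 + d ^+ 2) <= M2 * (e k + `|d|).
      by rewrite ler_wpM2l // d_sq lerD.
    have H4 : 0 <= `|g| * `|d| by rewrite mulr_ge0.
    have H5 : 0 <= `|p| * e k by rewrite mulr_ge0 // ltW.
    by move: tBd H1 H3 H4 H5; rewrite !sqrrN /M4; move=> *; lra.
  have z_t : `|z| * t <= M5 * U.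
    have H1 : `|z| * t <= M4 * (e k + `|d|) * t by rewrite ler_wpM2r.
    have H2 : e k * t <= e k by rewrite ler_piMr // ltW.
    have H3 : M4 * (e k * t + `|d| * t) <= M4 * (2 * U + (2 + 4 * M3) * U).
      by rewrite ler_wpM2l // lerD // (le_trans H2).
    by rewrite /M5; lra.
  have tU : t ^+ (N + 1 + C) <= U.
    rewrite !exprD expr1 (@le_trans _ _ (M5 * U * t ^+ C)) //.
      by rewrite ler_wpM2r ?exprn_ge0 // (le_trans _ z_t) // ler_wpM2r // ltW.
    by rewrite mulrAC ler_piMl.
  have : t ^+ ((N + 1 + C) * m0.+1) <= t ^+ n k.
    have H1 : U ^+ m0.+1 <= t ^+ n k.
      have -> : U ^+ m0.+1 = (u ^+ m0.+1) ^+ n k by rewrite -!exprM mulnC.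
      by apply: lerXn2r; rewrite ?nnegrE ?exprn_ge0 // ltW.
    rewrite exprM; apply: le_trans H1.
    by apply: lerXn2r; rewrite // nnegrE exprn_ge0.
  rewrite ler_iXn2l // => H; move: H Nn kC; clear; nia.
(* With z = 0 the expansion of B reads d = beta e_k up to the second-order error [b]. *)
pose b := d - beta * e k.
have b_le : `|b| <= M6 * (e k ^+ 2 + d ^+ 2).
  have -> : b = (z - g * - e k - p * - d) / p by rewrite z0 /b /beta; field.
  by rewrite !sqrrN in tBd; rewrite normrM normfV /M6 mulrAC ler_wpM2r ?invr_ge0.
have d_le : `|d| <= M8 * e k.
  have H1 : `|d| <= `|b| + `|beta| * e k.
    have {1}-> : d = b + beta * e k by rewrite /b; ring.
    by rewrite (le_trans (ler_normD _ _)) // normrM (gtr0_norm ek0).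
  have H2 : M6 * e k ^+ 2 <= M6 * e k by rewrite ler_wpM2l.
  have H3 : 2 * (M6 + 1) * `|d| * `|d| <= `|d| by rewrite ler_piMl.
  have H4 : 0 <= `|d| * `|d| by rewrite mulr_ge0.
  by move: b_le H1 H2 H3 H4 d_ge0 d_small; rewrite d_sq /M8; move=> *; lra.
have b_le2 : `|b| <= M6 * (1 + M8 ^+ 2) * e k ^+ 2.
  have H1 : d ^+ 2 <= (M8 * e k) ^+ 2.
    rewrite -(real_normK (num_real d)) lerXn2r ?nnegrE // mulr_ge0 // ltW //.
  have H2 : M6 * (e k ^+ 2 + d ^+ 2) <= M6 * (e k ^+ 2 + (M8 * e k) ^+ 2).
    by rewrite ler_wpM2l // lerD2l.
  rewrite (le_trans b_le) // (le_trans H2) // exprMn.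
  by lra.
(* The second-order error of the implicit root; its factor r = S_k'(u) satisfies |r| t <= 1. *)
pose s := a + alpha * e k.
have -> : E k - (beta - alpha * r) * e k = b + r * s + tau by rewrite dE /b /s; ring.
have H1 : `|b + r * s + tau| <= `|b| + `|r * s| + `|tau|.
  by rewrite (le_trans (ler_normD _ _)) // lerD2r ler_normD.
have H2 : `|b| * t <= `|b| by rewrite ler_piMr // ltW.
have H3 : `|r * s| * t <= M1 * e k ^+ 2.
  rewrite normrM mulrAC (le_trans _ Ha) // ler_piMl // (le_trans _ mt_le1) //.
  by rewrite ler_wpM2r.
have H4 : `|tau| * t <= M3 ^+ 2 * e k ^+ 2.
  rewrite (@le_trans _ _ (a ^+ 2)) //.
    rewrite (@le_trans _ _ (mk%:R * a ^+ 2 * t)) ?ler_wpM2r // mulrAC ler_piMl //.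
    exact: sqr_ge0.
  rewrite -exprMn -(real_normK (num_real a)) lerXn2r ?nnegrE // mulr_ge0 //; exact: ltW.
have H5 : `|b + r * s + tau| * t <= (`|b| + `|r * s| + `|tau|) * t by rewrite ler_wpM2r.
by lra.
Qed.

Lemma no_larger_image : False.
Proof.
have [alpha [beta [M [K [M_ge0 HK]]]]] := first_order_estimate.
(* In [M'], 8 M comes from the errors at k and k+1, each at most 4 M t^(2 n_k), and 2 |alpha| from
   the change of [rho] times e_(k+1). *)
pose rho k := beta - alpha * dS k; pose M' := 8 * M + 2 * `|alpha|.
have M'_ge0 : 0 <= M' by rewrite addr_ge0 // mulr_ge0.
have t_ge0 : 0 <= t := ltW t_gt0.
(* The natural factor n_k from differentiating X^(n_k) is absorbed by [t]. *)
have drho k : `|rho k.+1 - rho k| * t <= `|alpha| * u ^+ (n k).-1.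
  have -> : rho k.+1 - rho k = - (alpha * (u ^+ (n k).-1 *+ n k)).
    by rewrite /rho dS_succ; ring.
  rewrite normrN normrM -mulrA ler_wpM2l // ger0_norm; last first.
    by rewrite mulrn_wge0 // exprn_ge0 // ltW.
  by rewrite mulrnAl -mulrnAr ler_piMr ?exprn_ge0 // ltW.
have step1 k : (K <= k)%N -> `|u ^+ n k - rho k * t ^+ n k| * t <= M' * (t ^+ n k * t ^+ n k).
  move=> Kk; have := HK k.+1 (leq_trans Kk (leqnSn k)); have := HK k Kk.
  rewrite -/(rho k) -/(rho k.+1); have := drho k.
  have Ek : u ^+ n k = E k - E k.+1 by rewrite (ES k) addrC addKr.
  have ek : t ^+ n k = e k - e k.+1 by rewrite (eS k) addrC addKr.
  have e0 := e_gt0 k; have e0' := e_gt0 k.+1; have le_e := e_le k.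
  (* Doubling of the exponents makes e_(k+1) of second order in t^(n_k). *)
  have le_e' : e k.+1 <= 2 * (t ^+ n k * t ^+ n k).
    rewrite (le_trans (e_le k.+1)) // ler_wpM2l // -exprD tX_le // addnn.
    by rewrite (leq_trans _ (n_growth k)) // -addn2 leq_addr.
  have T0 := tX_gt0 (n k); have T1 : t ^+ n k <= 1 by rewrite exprn_ile1 // ltW.
  have a0 := normr_ge0 alpha.
  have sq_e : e k ^+ 2 <= 4 * (t ^+ n k * t ^+ n k).
    have -> : 4 * (t ^+ n k * t ^+ n k) = (2 * t ^+ n k) ^+ 2 by ring.
    by apply: lerXn2r; rewrite // nnegrE ?mulr_ge0 // ltW.
  have sq_e' : e k.+1 ^+ 2 <= e k ^+ 2.
    by apply: lerXn2r; rewrite ?nnegrE ?ltW // e_mono.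
  have uk1 : `|alpha| * u ^+ (n k).-1 <= `|alpha|.
    by rewrite ler_piMr // exprn_ile1 // ltW.
  have -> : u ^+ n k - rho k * t ^+ n k = (E k - rho k * e k)
      - (E k.+1 - rho k.+1 * e k.+1) - (rho k.+1 - rho k) * e k.+1.
    by rewrite Ek ek; ring.
  move=> H1 H2 H3.
  have H4 : `|(rho k.+1 - rho k) * e k.+1| * t <= `|alpha| * e k.+1.
    by rewrite normrM (gtr0_norm e0') mulrAC ler_wpM2r ?(le_trans H1) // ltW.
  have H5 : M * e k ^+ 2 <= M * (4 * (t ^+ n k * t ^+ n k)) by rewrite ler_wpM2l.
  have H6 : M * e k.+1 ^+ 2 <= M * e k ^+ 2 by rewrite ler_wpM2l.
  have H7 : `|alpha| * e k.+1 <= `|alpha| * (2 * (t ^+ n k * t ^+ n k)) by rewrite ler_wpM2l.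
  move: H2 H3 H4; set X := E k - _; set Y := E k.+1 - _; set Z := _ * e k.+1 => H2 H3 H4.
  have H8 : `|X - Y - Z| * t <= (`|X| + `|Y| + `|Z|) * t.
    by rewrite ler_wpM2r // (le_trans (ler_normB _ _)) // lerD2r ler_normB.
  by move: H2 H3 H4 H5 H6 H7 H8; rewrite /M'; move=> *; lra.
pose W := u / t; have W_gt1 : 1 < W by rewrite ltr_pdivlMr // mul1r.
have step2 k : (K <= k)%N -> `|W ^+ n k - rho k| * t <= M' * t ^+ n k.
  move=> Kk; rewrite -(ler_pM2r (tX_gt0 (n k))) -[leRHS]mulrA (le_trans _ (step1 k Kk)) //.
  rewrite mulrAC -[t ^+ n k in leLHS](gtr0_norm (tX_gt0 (n k))) -normrM mulrBl.
  by rewrite /W expr_div_n divfK // gt_eqF.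
have ut0 : u - t != 0 by rewrite subr_eq0 gt_eqF.
(* u - t = (W - 1) t is above some t^N. It is at most (W^(n_(k+1)) - W^(n_k)) t, hence at most two
   approximation errors plus one change of [rho], together (2 M' + |alpha|) u^(n_k - 1), which falls
   to t^N or below for large k. *)
have [N tN] := above_power_neq0 ut0; have [K' HK'] := eventually_small (2 * M' + `|alpha|) N.
pose k := (K + K'.+1)%N.
have nk : (k <= n k)%N := n_ge k.
have := HK' (n k).-1; have -> : (K' <= (n k).-1)%N.
  by rewrite -ltnS prednK ?(leq_trans _ nk) // /k ?addnS // ltnS leq_addl.
move=> /(_ isT); apply/negP; rewrite -ltNge (lt_le_trans tN) //.
rewrite gtr0_norm ?subr_gt0 //.
have Kk : (K <= k)%N by exact: leq_addr.
have := step2 k Kk; have := step2 k.+1 (leq_trans Kk (leqnSn k)); have := drho k.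
have T0 : t ^+ n k.+1 <= t ^+ n k by rewrite tX_le // ltnW.
have T1 : t ^+ n k <= u ^+ (n k).-1.
  by rewrite (le_trans (tu_le (n k))) // ler_wiXn2l ?leq_pred // ltW.
have W1 : W - 1 <= W ^+ n k.+1 - W ^+ n k.
  have H1 : W ^+ (n k).+1 <= W ^+ n k.+1 by rewrite ler_weXn2l // ltW.
  have H2 : 1 <= W ^+ n k by rewrite exprn_ege1 // ltW.
  have : 0 <= (W ^+ n k - 1) * (W - 1) by rewrite mulr_ge0 // subr_ge0 // ltW.
  by move: H1 H2; rewrite exprS; move=> *; lra.
have Wt : (W - 1) * t = u - t by rewrite mulrBl mul1r /W divfK // gt_eqF.
have H1 : (W - 1) * t <= (W ^+ n k.+1 - W ^+ n k) * t by rewrite ler_wpM2r.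
have H2 : M' * t ^+ n k.+1 <= M' * t ^+ n k by rewrite ler_wpM2l.
have H3 : M' * t ^+ n k <= M' * u ^+ (n k).-1 by rewrite ler_wpM2l.
rewrite -Wt; move: H1; set a := W ^+ n k.+1; set b := W ^+ n k => H1.
have H4 : (a - b) * t <= (`|a - rho k.+1| + `|b - rho k| + `|rho k.+1 - rho k|) * t.
  rewrite ler_wpM2r // (le_trans (ler_norm _)) //.
  have -> : a - b = (a - rho k.+1) - (b - rho k) + (rho k.+1 - rho k) by ring.
  by rewrite (le_trans (ler_normD _ _)) // lerD2r ler_normB.
by lra.
Qed.

End Automorphism.

Lemma rmorph_bij_fixes_t (f : {rmorphism F -> F}) : bijective f -> f t = t.
Proof.
move=> [g fK gK]; have [lt_t|gt_t|//] := ltgtP t (f t).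
  by have [] := no_larger_image lt_t (ex_intro _ (g t) (gK t)).
(* If [f t < t], the inverse moves [t] upwards; it is made a ring morphism so that [no_larger_image]
   applies. *)
pose gZ := GRing.isZmodMorphism.Build F F g (can2_zmod_morphism fK gK).
pose gM := GRing.isMonoidMorphism.Build F F g (can2_monoid_morphism fK gK).
pose g' : {rmorphism F -> F} := HB.pack g gZ gM.
have lt_g : t < g' t.
  by rewrite -{1}[t]fK; exact: (@rmorph_rcf_lt F g').
by have [] := no_larger_image lt_g (ex_intro _ (f t) (fK t)).
Qed.

Lemma diagonal_rigid : rigid F.
Proof.
move=> f f_bij z.
have ft := rmorph_bij_fixes_t f_bij.
have fy : f y = y.
  apply/eqP; rewrite -subr_eq0; apply: contrapT => /negP/above_power_neq0[N].
  apply/negP; rewrite -leNgt.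
  (* As [f] fixes S_k(t), f y - y = f(e_k) - e_k; both terms lie between 0 and 2 t^(n_k), which for
     k = N+1 is below t^N. *)
  have H k : f y - rat_eval (S k) t = f (e k) by rewrite /e rmorphB rat_eval_rmorph ft.
  have E0 := rmorph_rcf_gt0 f (e_gt0 N.+1); have e0 := e_gt0 N.+1.
  have E1 : f (e N.+1) <= 2 * t ^+ n N.+1.
    have := e_le N.+1; rewrite le_eqVlt => /orP[/eqP ->|/(rmorph_rcf_lt f)/ltW].
      by rewrite rmorphM rmorphXn ft rmorph_nat.
    by rewrite rmorphM rmorphXn ft rmorph_nat.
  have e1 := e_le N.+1; have T := tX_le (n_ge N.+1); have T2 := tX_nat N 2.
  have -> : f y - y = f (e N.+1) - e N.+1 by rewrite -H /e; ring.
  by rewrite ler_norml; apply/andP; split; lra.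
have [A [A0 Az]] := algebraic z; apply: rmorph_rcf_fixes_root A0 _ Az.
by apply/polyP => i; rewrite !coef_map /= evalQ2_map ft fy.
Qed.

End DiagonalField.

(** * The rigid field *)

Lemma slice_rmorph (F G : rcfType) (h : {rmorphism F -> G}) t y A :
  map_poly h (slice t y A) = slice (h t) (h y) A.
Proof. by apply/polyP => i; rewrite !coef_map /= evalQ2_map. Qed.

Section AlgebraicClosureOfQty.
Variables (L : rcfType) (t y : L) (n : nat -> nat).
Hypotheses (t_gt0 : 0 < t) (t_inf : forall m, t *+ m < 1).
Hypothesis n_growth : forall k, ((n k).*2.+2 <= n k.+1)%N.
Hypothesis y_bounds : forall k,
  0 < y - rat_eval (lacunary n k) t /\ y - rat_eval (lacunary n k) t <= t ^+ n k *+ 2.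
Hypothesis diag : forall A B m, exists k0, forall k, (k0 <= k)%N -> forall u,
  let S := lacunary n k in let s := rat_eval S t in
  slice t s A != 0 -> root (slice t s A) u -> (slice t s B).[rat_eval S u] != 0 ->
  exists N, t ^+ N < `|(slice t s B).[rat_eval S u]| /\ (N * m <= n k)%N.

Let ev : {rmorphism {poly {poly rat}} -> L} := evalQ2 t y.
Let F : rcfType := alg_field ev.
Let h : {rmorphism F -> L} := val.

Let tA : t \in alg_image ev.
Proof. by have := alg_image_ev ev 'X%:P; rewrite /= evalQ2_polyC map_polyX hornerX. Qed.
Let yA : y \in alg_image ev.
Proof. by have := alg_image_ev ev 'X; rewrite /= evalQ2_X. Qed.
Let tF : F := AlgField tA.
Let yF : F := AlgField yA.

Let h_lt (x z : F) : (x < z) = (h x < h z). Proof. exact: alg_val_lt. Qed.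
Let h_le (x z : F) : (x <= z) = (h x <= h z). Proof. exact: alg_val_le. Qed.
Let h_norm (x : F) : h `|x| = `|h x|.
Proof.
have [x0|x0] := leP 0 x.
  by rewrite !ger0_norm // -(rmorph0 h) -h_le.
by rewrite !ltr0_norm ?rmorphN // -(rmorph0 h) -h_lt.
Qed.

Let tF_gt0 : 0 < tF. Proof. by rewrite h_lt rmorph0. Qed.
Let tF_inf m : tF *+ m < 1. Proof. by rewrite h_lt rmorphMn rmorph1. Qed.
Let yF_bounds k : 0 < yF - rat_eval (lacunary n k) tF /\
  yF - rat_eval (lacunary n k) tF <= tF ^+ n k *+ 2.
Proof.
by rewrite h_lt h_le rmorph0 rmorphMn rmorphXn rmorphB rat_eval_rmorph; exact: y_bounds.
Qed.

(** Roots in [F] are roots in [L], and the inclusion preserves values and order. *)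
Let diagF A B m : exists k0, forall k, (k0 <= k)%N -> forall u,
  let S := lacunary n k in let s := rat_eval S tF in
  slice tF s A != 0 -> root (slice tF s A) u -> (slice tF s B).[rat_eval S u] != 0 ->
  exists N, tF ^+ N < `|(slice tF s B).[rat_eval S u]| /\ (N * m <= n k)%N.
Proof.
have [k0 Hk0] := diag A B m; exists k0 => k /Hk0 + u S s A0 Au Bu => /(_ (h u)) /=.
have hs : h s = rat_eval S t by rewrite rat_eval_rmorph.
have hz : h (slice tF s B).[rat_eval S u] = (slice t (rat_eval S t) B).[rat_eval S (h u)].
  by rewrite -horner_map slice_rmorph hs rat_eval_rmorph.
have hA : map_poly h (slice tF s A) = slice t (rat_eval S t) A by rewrite slice_rmorph hs.
rewrite -/S -hA map_poly_eq0 -hz fmorph_eq0 => /(_ A0 (rmorph_root h Au) Bu)[N [tN Nk]].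
by exists N; split=> //; rewrite h_lt rmorphXn h_norm.
Qed.

Let algebraicF z : exists A, slice tF yF A != 0 /\ root (slice tF yF A) z.
Proof.
have /alg_image_rootP[A [A0 Az]] := valP z; exists A.
have hA : map_poly h (slice tF yF A) = map_poly ev A by exact: slice_rmorph.
by rewrite -(map_poly_eq0 h) hA -(fmorph_root h) hA.
Qed.

Lemma rigid_algebraic_closure :
  exists R : rcfType, non_archimedean R /\ trdeg2 R /\ rigid R.
Proof.
exists F; split; [|split].
- exists tF^-1 => m; rewrite -[_^-1]mul1r ltr_pdivlMr // mulrC mulr_natr; exact: tF_inf.
- exists tF, yF; split.
    exact: (diagonal_alg_indep2 tF_gt0 tF_inf n_growth yF_bounds diagF).
  move=> z; have [A [A0 Az]] := algebraicF z; exists (slice tF yF A).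
  split=> //; split=> // i; exists A`_i, 1.
  by rewrite rmorph1 oner_eq0 divr1 coef_map.
exact: (diagonal_rigid tF_gt0 tF_inf n_growth yF_bounds diagF algebraicF).
Qed.

End AlgebraicClosureOfQty.

Theorem theorem2p2 :
  exists R : rcfType, non_archimedean R /\ trdeg2 R /\ rigid R.
Proof.
have [L [t [t_gt0 [t_inf lacunary_sum]]]] := nonarchimedean_rcf_with_lacunary_sums realalg.
(* The exponents depend only on [L] and [t]; [y] comes afterwards, which is why [L] provides a sum
   for every increasing sequence. *)
have [n [n_growth diag]] := exists_diagonal_exponents t_gt0 t_inf.
have [|y yP] := lacunary_sum n; first by move=> k; have := n_growth k; lia.
apply: (@rigid_algebraic_closure L t y n) => // k.
have -> : rat_eval (lacunary n k) t = \sum_(i < k) t ^+ n i.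
  elim: k => [|k IH]; first by rewrite /rat_eval /lacunary !big_ord0 rmorph0 horner0.
  by rewrite rat_eval_lacunaryS IH big_ord_recr.
exact: yP.
Qed.
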